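(* Let $1\le p\le n$ and let $g_1,\ldots,g_p\in\mathbb{Q}[X_1,\ldots,X_n]$ be a reduced regular sequence, i.e. a regular sequence such that for every $1\le k\le p$ the ideal $(g_1,\ldots,g_k)$ is radical. Then there is a non-empty Zariski-open subset $\mathcal{U}\subset GL_n(\mathbb{C})$ such that for every $A\in\mathcal{U}\cap GL_n(\mathbb{Q})$ the polynomials $f_k(X):=g_k(AX)$, $1\le k\le p$, have the following property (that is: the following holds whenever the variables are in generic position with respect to $f_1,\ldots,f_p$). Let $W_0:=V(f_1,\ldots,f_p)\subset\mathbb{C}^n$, let $m$ be the upper left $(p-1)$-minor of the Jacobian $J(f_1,\ldots,f_p)$, and for $p\le j\le n$ let $M_j$ be the $p$-minor of $J(f_1,\ldots,f_p)$ given by the columns $1,\ldots,p-1,j$. Then for every $1\le i\le n-p$ the $i$-th formal polar variety $W_i$ of $W_0$, localized with respect to the closed set $\mathrm{Sing}\,W_0\cup V(m)$, i.e. the set $W_i\setminus(\mathrm{Sing}\,W_0\cup V(m))$, is either empty or a smooth variety of codimension $p+i$ in $\mathbb{C}^n$, and outside of $\mathrm{Sing}\,W_0\cup V(m)$ it is described by the equations $$f_1=0,\ldots,f_p=0,\; M_p=0,\ldots,M_{p+i-1}=0.$$ Moreover, the polynomials $f_1,\ldots,f_p,M_p,\ldots,M_{p+i-1}$ form a regular sequence outside of $\mathrm{Sing}\,W_0\cup V(m)$.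
   Context: $J(f_1,\ldots,f_p):=\left[\frac{\partial f_k}{\partial X_j}\right]_{1\le k\le p,\,1\le j\le n}$ is the Jacobian, and $V(\cdot)$ denotes the set of common zeros in $\mathbb{C}^n$. The minor $m$ is $\det\left[\frac{\partial f_k}{\partial X_j}\right]_{1\le k\le p-1,\,1\le j\le p-1}$ (equal to $1$ if $p=1$). A point $x\in W_0$ is called smooth (in $W_0$) if $J(f_1,\ldots,f_p)(x)$ has rank $p$, and singular otherwise; $\mathrm{Sing}\,W_0$ is the set of singular points of $W_0$. For $1\le i\le n-p$, let $\Delta_i\subset\mathbb{C}^n$ be the determinantal variety of common zeros of all $p$-minors of the submatrix of $J(f_1,\ldots,f_p)$ formed by the columns $1,\ldots,p+i-1$. The $i$-th formal polar variety of $W_0$ is $W_i:=W_0\cap\Delta_i$. Polynomials $h_1,\ldots,h_r$ form a regular sequence outside of a closed set $Z\subset\mathbb{C}^n$ if, at every point $x\in V(h_1,\ldots,h_r)\setminus Z$, they form a regular sequence in the local ring of $\mathbb{C}^n$ at $x$. *)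

(* Defs.v *)
(* MathComp + multinomials; classical sets and realType from MathComp-Analysis. *)
From HB Require Import structures.
From mathcomp Require Import all_boot all_order all_algebra.
From mathcomp Require Export complex mpoly.
From mathcomp Require Import boolp classical_sets reals.

Set Implicit Arguments.
Unset Strict Implicit.
Unset Printing Implicit Defensive.

Import GRing.Theory.

Local Open Scope ring_scope.
Local Open Scope classical_set_scope.

Section RegularSequences.
Variable A : comNzRingType.

Definition gen_ideal (s : seq A) : set A :=
  [set a | exists c : 'I_(size s) -> A, a = \sum_i c i * s`_i].

Definition radical_ideal (I : set A) : Prop :=
  forall (a : A) (k : nat), I (a ^+ k) -> I a.

(* The second clause is the usual requirement that the quotient by the whole
   sequence be nonzero. *)
Definition regular_seq (s : seq A) : Prop :=
  (forall k, (k < size s)%N -> forall a : A,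
     gen_ideal (take k s) (s`_k * a) -> gen_ideal (take k s) a)
  /\ ~ gen_ideal s 1.

Definition reduced_regular_seq (s : seq A) : Prop :=
  regular_seq s /\
  forall k, (0 < k <= size s)%N -> radical_ideal (gen_ideal (take k s)).

End RegularSequences.

(* Points of affine space are row vectors x; q.@[x 0] is the value of q at x. *)
Section LocalRing.
Variables (K : fieldType) (n : nat).
Implicit Type x : 'rV[K]_n.

Definition regular_at x : {pred {fraction {mpoly K[n]}}} :=
  fun u => `[< exists a b : {mpoly K[n]},
                 b.@[x 0] != 0 /\ u = tofrac a / tofrac b >].

Lemma regular_at_tofrac x (q : {mpoly K[n]}) : tofrac q \in regular_at x.
Proof.
apply/asboolP; exists q, 1; split; first by rewrite meval1 oner_eq0.
by rewrite tofrac1 divr1.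
Qed.

Lemma regular_at_subring x : subring_closed (regular_at x).
Proof.
have nz (b : {mpoly K[n]}) : b.@[x 0] != 0 -> tofrac b != 0.
  by rewrite tofrac_eq0; apply: contraNneq => ->; rewrite meval0.
split.
- by rewrite -tofrac1; exact: regular_at_tofrac.
- move=> u v /asboolP[a [b [b0 ->]]] /asboolP[c [d [d0 ->]]].
  apply/asboolP; exists (a * d - c * b), (b * d); split.
    by rewrite mevalM mulf_neq0.
  by rewrite -mulNr addf_div ?nz // tofracB !tofracM mulNr.
- move=> u v /asboolP[a [b [b0 ->]]] /asboolP[c [d [d0 ->]]].
  apply/asboolP; exists (a * c), (b * d); split.
    by rewrite mevalM mulf_neq0.
  by rewrite !tofracM mulf_div.
Qed.

HB.instance Definition _ x :=
  GRing.isSubringClosed.Build _ (regular_at x) (regular_at_subring x).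

(* The local ring of affine space at x: the rational functions whose
   denominator can be chosen not to vanish at x. *)
Record local_ring x := LocalRing {
  local_val :> {fraction {mpoly K[n]}};
  _ : local_val \in regular_at x }.

HB.instance Definition _ x := [isSub for @local_val x].
HB.instance Definition _ x := [Choice of local_ring x by <:].
HB.instance Definition _ x := [SubChoice_isSubComNzRing of local_ring x by <:].

Definition germ x (q : {mpoly K[n]}) : local_ring x :=
  LocalRing (regular_at_tofrac x q).

End LocalRing.

Section Zariski.
Variables (K : fieldType) (n : nat).
Implicit Types (S : set {mpoly K[n]}) (X Y Z L : set 'rV[K]_n) (x v : 'rV[K]_n).

Definition zeros S : set 'rV[K]_n :=
  [set x | forall q, S q -> q.@[x 0] = 0].

Definition vanishing X : set {mpoly K[n]} :=
  [set q | forall x, X x -> q.@[x 0] = 0].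

Definition zclosed X : Prop := exists S, X = zeros S.

Definition zclosure X : set 'rV[K]_n := zeros (vanishing X).

Definition zlocally_closed X : Prop :=
  exists Y Z, [/\ zclosed Y, zclosed Z & X = Y `\` Z].

Definition zirreducible X : Prop :=
  X !=set0 /\
  forall Y Z, zclosed Y -> zclosed Z ->
    X `<=` Y `|` Z -> X `<=` Y \/ X `<=` Z.

Definition zcomponent L X : Prop :=
  [/\ X `<=` L, zirreducible X &
      forall Y, zirreducible Y -> Y `<=` L -> X `<=` Y -> Y = X].

Definition zchain X (c : nat) : Prop :=
  exists T : nat -> set 'rV[K]_n,
    [/\ T 0%N = X,
        forall k, (k <= c)%N -> zclosed (T k) /\ zirreducible (T k) &
        forall k, (k < c)%N -> T k `<` T k.+1].

(* X, closed and irreducible, has (Krull) codimension c in affine space. *)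
Definition has_codim X (c : nat) : Prop :=
  zchain X c /\ forall d, zchain X d -> (d <= c)%N.

Definition pure_codim L (c : nat) : Prop :=
  forall X, zcomponent L X -> has_codim (zclosure X) c.

(* Zariski tangent space.  For x in a locally closed L it may be computed from
   all polynomials vanishing on L, as L is open in its closure. *)
Definition tangent_space L x : set 'rV[K]_n :=
  [set v | forall q, vanishing L q ->
             \sum_(j < n) (q^`M(j)).@[x 0] * v 0 j = 0].

Definition smooth_variety (c : nat) L : Prop :=
  [/\ zlocally_closed L,
      pure_codim L c &
      forall x, L x ->
        exists T : {vspace 'rV[K]_n},
          (forall v, v \in T <-> tangent_space L x v) /\ (\dim T + c)%N = n].

Definition regular_seq_outside (X : set 'rV[K]_n) (h : seq {mpoly K[n]}) : Prop :=
  forall x, (zeros [set` h] `\` X) x -> regular_seq [seq germ x q | q <- h].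

(* Zariski-open subsets of GL_n: the traces on GL_n of the open subsets of the
   affine space of matrices, the n * n coordinates being the entries. *)
Definition zopen_GL (U : set 'M[K]_n) : Prop :=
  exists S : set {mpoly K[n * n]},
    U = [set A | A \in unitmx /\ exists2 q, S q & q.@[mxvec A 0] != 0].

End Zariski.

(* The polynomial g(A X), X being the column of the variables. *)
Definition lin_subst (F : fieldType) (n : nat) (A : 'M[F]_n) (g : {mpoly F[n]}) :
  {mpoly F[n]} :=
  g \mPo [tuple \sum_(j < n) A i j *: 'X_j | i < n].

Section PolarVarieties.
Variables (K : fieldType) (n p : nat).
Implicit Type f : p.-tuple {mpoly K[n]}.

Definition jacobian f : 'M[{mpoly K[n]}]_(p, n) :=
  \matrix_(k < p, j < n) (tnth f k)^`M(j).

Definition jacobian_at f (x : 'rV[K]_n) : 'M[K]_(p, n) :=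
  map_mx (meval (x 0)) (jacobian f).

Definition max_minor f (c : 'I_p -> 'I_n) : {mpoly K[n]} :=
  \det (colsub c (jacobian f)).

Definition sing f : set 'rV[K]_n :=
  [set x | zeros [set` f] x /\ \rank (jacobian_at f x) != p].

(* With 0-based column indices, the columns 1, ..., p+i-1 are those of index
   < p.-1 + i (for p > 0). *)
Definition determinantal f (i : nat) : set 'rV[K]_n :=
  [set x | forall c : 'I_p -> 'I_n,
             {homo c : a b / (a < b)%N} -> (forall k, (c k < p.-1 + i)%N) ->
             (max_minor f c).@[x 0] = 0].

Definition polar_variety f (i : nat) : set 'rV[K]_n :=
  zeros [set` f] `&` determinantal f i.

Definition ul_minor (le_pn : (p <= n)%N) f : {mpoly K[n]} :=
  \det (mxsub (widen_ord (leq_pred p))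
              (widen_ord (leq_trans (leq_pred p) le_pn)) (jacobian f)).

(* The minor of the columns 1, ..., p-1 and j. *)
Definition bordered_minor (le_pn : (p <= n)%N) f (j : 'I_n) : {mpoly K[n]} :=
  max_minor f (fun k => if (k < p.-1)%N then widen_ord le_pn k else j).

(* f_1, ..., f_p, M_p, ..., M_(p+i-1); the 1-based column numbers
   p, ..., p+i-1 are the indices p.-1 <= j < p.-1 + i. *)
Definition polar_equations (le_pn : (p <= n)%N) f (i : nat) : seq {mpoly K[n]} :=
  f ++ [seq bordered_minor le_pn f j
       | j <- [seq j : 'I_n <- enum 'I_n | (p.-1 <= j < p.-1 + i)%N]].

End PolarVarieties.

(* Main.v *)
(* Write y = A x and let J be the Jacobian of g at y.  The bordered minor M_t
   is the value of a linear form omega(y) at the t-th column a_t of A, where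
   omega is the combination of the rows of J by the cofactors of the columns
   J a_1, ..., J a_(p-1); it does not vanish where m does not and J has rank p.

   Transversality is checked at the generic matrix.  If the entries of A are
   independent transcendentals and y is algebraic over Q(A), the derivation of
   Q(A) with respect to an entry of a_t extends to y.  Differentiating
   g(y) = 0 and M_t(y) = 0 shows that the Jacobian of (g, M_p, ..., M_(p+i-1))
   has independent rows at every such common zero with omega(y) <> 0.  By the
   Nullstellensatz over Q[A] this is witnessed by a polynomial identity with a
   nonzero denominator Phi in Q[A], which specializes to every A with
   Phi(A) <> 0.

   It remains that polynomials h_1, ..., h_r with independent gradients at a
   common zero x form a regular sequence there and define a smooth germ of
   codimension r.  They extend to local coordinates, which identify
   K[X] / m_x^N with K[z] / (z)^N for all N, so by Krull's intersection theorem
   the ideals (h_1, ..., h_k) O_x are prime; the Nullstellensatz and a count of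
   algebraically independent coordinates turn this into the dimension
   statement. *)

Require Import Defs.
From HB Require Import structures.
From mathcomp Require Import all_boot all_order all_algebra all_field.
From mathcomp Require Import ring boolp classical_sets reals.

Set Implicit Arguments.
Unset Strict Implicit.
Unset Printing Implicit Defensive.

Import Order.TTheory GRing.Theory Num.Theory.

Local Open Scope ring_scope.
Local Open Scope classical_set_scope.

(** * Ideals and primes *)

(** The derivation with respect to the entry in row l and column t of A, for t >= p, moves M_t
    explicitly, whereas omega, which is free of these columns, and the remaining M_j move only
    through y. Taking all such t makes the M-block of the Jacobian diagonal along the vectors D(y),
    with omega_l on the diagonal up to sign. This replaces an appeal to Sard or Bertini and stays
    purely algebraic; the price is a closure of Q(A) to which the derivations extend, and a
    Nullstellensatz whose coefficients lie in a ring rather than in the closed field. What crosses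
    over to the complex numbers is only an ideal membership over Q[A].

    On the local side all ideals are kept inside K[X]: an ideal of the local ring is replaced by its
    contraction, tested modulo powers of m_x. Orders of vanishing at the origin then do the work of
    completions and of the general theory of regular local rings. *)

Lemma mulrBB (R : pzRingType) (a b c d : R) :
  a * b - c * d = (a - c) * b + c * (b - d).
Proof. by rewrite mulrBl mulrBr addrA subrK. Qed.

Record ideal_set (A : comNzRingType) (I : set A) : Prop := IdealSet {
  ideal_set0 : I 0;
  ideal_setD : forall a b, I a -> I b -> I (a + b);
  ideal_setM : forall a b, I b -> I (a * b) }.

Record prime_set (A : comNzRingType) (P : set A) : Prop := PrimeSet {
  prime_ideal : ideal_set P;
  prime_proper : ~ P 1;
  prime_mul : forall a b, P (a * b) -> P a \/ P b }.

Section Ideals.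
Variable A : comNzRingType.
Implicit Types (I P M : set A) (s : seq A).

Lemma ideal_setN I a : ideal_set I -> I a -> I (- a).
Proof. by move=> hI Ia; rewrite -mulN1r; apply: ideal_setM. Qed.

Lemma ideal_setB I a b : ideal_set I -> I a -> I b -> I (a - b).
Proof. by move=> hI Ia Ib; apply: ideal_setD => //; apply: ideal_setN. Qed.

Lemma ideal_setMr I a b : ideal_set I -> I a -> I (a * b).
Proof. by move=> hI Ia; rewrite mulrC; apply: ideal_setM. Qed.

Lemma ideal_set_sum I (T : Type) (r : seq T) (Q : pred T) (F : T -> A) :
  ideal_set I -> (forall i, Q i -> I (F i)) -> I (\sum_(i <- r | Q i) F i).
Proof.
move=> hI IF; elim/big_ind: _ => //; first exact: ideal_set0.
by move=> a b Ia Ib; apply: ideal_setD.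
Qed.

Lemma ideal_set_cancel I a b : ideal_set I -> I (a + b) -> I b -> I a.
Proof. by move=> hI Iab Ib; rewrite -(addrK b a); apply: ideal_setB. Qed.

Lemma prime_exp P a k : prime_set P -> P (a ^+ k) -> P a.
Proof.
move=> hP; elim: k => [|k IHk]; first by rewrite expr0 => /(prime_proper hP).
by rewrite exprS => /(prime_mul hP)[|/IHk].
Qed.

Lemma gen_ideal_ideal s : ideal_set (gen_ideal s).
Proof.
split=> [|a b [c ->] [d ->]|a b [c ->]].
- by exists (fun=> 0); rewrite big1 // => i _; rewrite mul0r.
- by exists (fun i => c i + d i); rewrite -big_split /=; apply: eq_bigr => i _;
    rewrite mulrDl.
- by exists (fun i => a * c i); rewrite mulr_sumr; apply: eq_bigr => i _;
    rewrite mulrA.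
Qed.

Lemma gen_ideal_mem s a : a \in s -> gen_ideal s a.
Proof.
move=> sa; have lt_as : (index a s < size s)%N by rewrite index_mem.
exists (fun i => (i == Ordinal lt_as)%:R).
rewrite (bigD1 (Ordinal lt_as)) //= eqxx mul1r nth_index // big1 ?addr0 //.
by move=> i /negPf ->; rewrite mul0r.
Qed.

Lemma gen_ideal_sub s I : ideal_set I -> (forall a, a \in s -> I a) ->
  gen_ideal s `<=` I.
Proof.
move=> hI sI a [c ->]; apply: ideal_set_sum => // i _; apply: ideal_setM => //.
by apply: sI; apply: mem_nth.
Qed.

(** An ideal maximal among those that contain I and miss M is prime: if a and b lie outside, M
    contains some j + c a and k + d b, and their product lies in the ideal as soon as a b does. *)
Lemma prime_avoiding I M : ideal_set I -> M 1 ->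
  (forall a b, M a -> M b -> M (a * b)) -> (forall a, I a -> ~ M a) ->
  exists P, [/\ prime_set P, I `<=` P & forall a, P a -> ~ M a].
Proof.
move=> hI M1 MM IM.
(* Zorn's lemma also asks for the union of the empty chain, which is no ideal; hence the condition
   bears on the union of X and I. *)
pose good X := ideal_set (X `|` I) /\ forall a, (X `|` I) a -> ~ M a.
have [F Fgood totF|X [[hX XM] maxX]] := @Zorn_bigcup A good.
  have [->|/set0P[X0 FX0]] := eqVneq F set0.
    by rewrite /good bigcup_set0 set0U.
  have UE a : (\bigcup_(X in F) X `|` I) a -> exists2 X, F X & (X `|` I) a.
    by case=> [[X FX Xa]|Ia]; [exists X => //; left|exists X0 => //; right].
  have EU a X : F X -> (X `|` I) a -> (\bigcup_(X in F) X `|` I) a.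
    by move=> FX [Xa|Ia]; [left; exists X|right].
  split=> [|a /UE[X FX Xa]]; last exact: (Fgood _ FX).2.
  split=> [|a b /UE[X FX Xa] /UE[Y FY Yb]|a b /UE[X FX Xb]].
  - by right; apply: ideal_set0.
  - have [XY|YX] := totF _ _ FX FY.
      apply: (EU _ Y FY); apply: (ideal_setD (Fgood _ FY).1) => //.
      by case: Xa => [/XY|]; [left|right].
    apply: (EU _ X FX); apply: (ideal_setD (Fgood _ FX).1) => //.
    by case: Yb => [/YX|]; [left|right].
  - by apply: (EU _ X FX); apply: (ideal_setM (Fgood _ FX).1).
pose J := X `|` I; rewrite -/J in hX XM.
(* By maximality the ideal J + (a) meets M. *)
have step a : ~ J a -> exists j c, M (j + c * a) /\ J j.
  move=> nJa; pose Y := [set y | exists j c, J j /\ y = j + c * a].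
  have IY : Y `|` I = Y.
    apply/setUidPl => y Iy; exists y, 0; rewrite mul0r addr0; split=> //.
    by right.
  apply: contrapT => nM; apply: (maxX Y); first last.
    rewrite /good IY; split=> [|y [j [c [Jj ->]]] My]; last first.
      by apply: nM; exists j, c.
    split=> [|_ _ [j [c [Jj ->]]] [k [d [Jk ->]]]|y _ [j [c [Jj ->]]]].
    - by exists 0, 0; rewrite mul0r addr0; split=> //; apply: ideal_set0.
    - exists (j + k), (c + d); rewrite mulrDl addrACA.
      by split=> //; apply: ideal_setD.
    - exists (y * j), (y * c); rewrite mulrDr mulrA; split=> //.
      exact: ideal_setM.
  split=> [y Xy|YX].
    by exists y, 0; rewrite mul0r addr0; split=> //; left.
  apply: nJa; left; apply: YX; exists 0, 1; rewrite mul1r add0r; split=> //.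
  exact: ideal_set0.
exists J; split=> //; last exact: subsetUr.
split=> // [/XM//|a b Jab].
have [Ja|/step[j [c [Mj Jj]]]] := pselect (J a); first by left.
have [Jb|/step[k [d [Mk Jk]]]] := pselect (J b); first by right.
case: (XM ((j + c * a) * (k + d * b))); last exact: MM.
rewrite mulrDl; apply: (ideal_setD hX); first exact: ideal_setMr.
rewrite mulrDr; apply: (ideal_setD hX); first exact: ideal_setM.
by rewrite mulrACA; apply: ideal_setM.
Qed.

End Ideals.

Lemma rmorph_gen_ideal (A B : comNzRingType) (phi : {rmorphism A -> B})
    (s : seq A) a :
  (forall b, b \in s -> phi b = 0) -> gen_ideal s a -> phi a = 0.
Proof.
move=> s0 [c ->]; rewrite rmorph_sum big1 // => i _.
by rewrite rmorphM (s0 s`_i) ?mulr0 // mem_nth.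
Qed.

Lemma prime_preimage (A B : comNzRingType) (phi : {rmorphism A -> B})
    (P : set B) : prime_set P -> prime_set [set a | P (phi a)].
Proof.
move=> hP; have hI := prime_ideal hP.
split=> [||a b]; last by rewrite /= rmorphM => /(prime_mul hP).
  split=> [|a b|a b]; rewrite /= ?rmorph0; first exact: ideal_set0.
    by rewrite rmorphD; apply: ideal_setD.
  by rewrite rmorphM; apply: ideal_setM.
by rewrite /= rmorph1; apply: prime_proper.
Qed.

(** * Nullstellensatz *)

Section PrimeExtension.
Variables (B : comNzRingType) (P : set {poly B}).
Hypothesis hP : prime_set P.

Let Q : set B := [set b | P b%:P].
Let inQ (f : {poly B}) := forall i, Q f`_i.

Let hI : ideal_set P. Proof. exact: prime_ideal. Qed.

Let hQ : prime_set Q. Proof. exact: (@prime_preimage _ _ polyC P). Qed.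

Let hQI : ideal_set Q. Proof. exact: prime_ideal. Qed.

Let inQP (f : {poly B}) : inQ f -> P f.
Proof.
move=> Qf; rewrite -[f]coefK poly_def; apply: ideal_set_sum => // i _.
by rewrite -mul_polyC; apply: ideal_setMr => //; apply: Qf.
Qed.

Let minimal_size (S : set {poly B}) (f : {poly B}) : S f ->
  exists2 g : {poly B}, S g & forall h : {poly B}, S h -> (size g <= size h)%N.
Proof.
move=> Sf; pose s n := `[< exists2 g : {poly B}, S g & size g = n >].
have ex_s : exists n, s n by exists (size f); apply/asboolP; exists f.
case: (ex_minnP ex_s) => n /asboolP[g Sg <-] min_g.
by exists g => // h Sh; apply: min_g; apply/asboolP; exists h.
Qed.

Let truncate (f : {poly B}) : Q (lead_coef f) -> f != 0 ->
  exists2 g : {poly B}, (size g < size f)%N & inQ (f - g).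
Proof.
move=> Ql f0; exists (take_poly (size f).-1 f).
  by apply: leq_ltn_trans (size_take_poly _ _) _; rewrite prednK // size_poly_gt0.
move=> i; rewrite coefB coef_take_poly.
case: ltnP => [lti|gei]; first by rewrite subrr; apply: ideal_set0.
rewrite subr0; move: gei; rewrite leq_eqVlt => /predU1P[<-//|lti].
by rewrite nth_default; [apply: ideal_set0|case: (size f) lti].
Qed.

Let pdiv (f g : {poly B}) : g != 0 -> exists k q r,
  [/\ (lead_coef g ^+ k)%:P * f = q * g + r & (size r < size g)%N].
Proof.
move=> g0; exists (Pdiv.Ring.rscalp f g), (Pdiv.Ring.rdivp f g), (Pdiv.Ring.rmodp f g).
by rewrite mul_polyC Pdiv.ComRing.rdivp_eq Pdiv.Ring.ltn_rmodpN0.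
Qed.

Let PM_lead c k f : ~ Q c -> P ((c ^+ k)%:P * f) -> P f.
Proof. by move=> nQc /(prime_mul hP)[/(prime_exp hQ)|]. Qed.

(* If some element of P has a coefficient outside Q, let g be a shortest one:
   modulo Q and up to its leading coefficient it generates P, so t can be any
   root of phi(g).  A shortest element of (s) + P outside P is then a constant,
   which makes s(t) invertible. *)
Lemma prime_extension (s : {poly B}) : ~ P s -> exists2 d : B, ~ Q d &
  forall (K : closedFieldType) (phi : {rmorphism B -> K}),
    (forall b, Q b -> phi b = 0) -> phi d != 0 ->
  exists t : K, (forall f, P f -> (map_poly phi f).[t] = 0) /\
                (map_poly phi s).[t] != 0.
Proof.
move=> nPs.
(* If all coefficients of elements of P lie in Q, every t is a zero of phi(P), and a coefficient of
   s outside Q serves as d. *)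
have [[f [Pf nQf]]|trans] := pselect (exists f, P f /\ ~ inQ f); last first.
  have PQ f : P f -> inQ f.
    by move=> Pf; apply: contrapT => nQ; apply: trans; exists f.
  have [i nQsi] : exists i, ~ Q s`_i.
    apply: contrapT => nps; apply/nPs/inQP => i; apply: contrapT => ?.
    by apply: nps; exists i.
  exists s`_i => // K phi phiQ phis.
  have /closed_nonrootP[t st] : map_poly phi s != 0.
    by apply: contraNneq phis => /(congr1 (fun f : {poly K} => f`_i));
      rewrite coef_map coef0 => ->.
  exists t; split=> // f Pf; suff -> : map_poly phi f = 0 by rewrite horner0.
  by apply/polyP => j; rewrite coef_map coef0; apply: phiQ; apply: PQ.
have [g [Pg nQg] min_g] :=
  @minimal_size [set f | P f /\ ~ inQ f] f (conj Pf nQf).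
have g0 : g != 0.
  by apply: contraPneq nQg => -> nQ0; apply: nQ0 => i; rewrite coef0; apply: ideal_set0.
have nQlg : ~ Q (lead_coef g).
  move=> /truncate/(_ g0)[h lt_hg Qgh].
  suff /min_g : P h /\ ~ inQ h by rewrite leqNgt lt_hg.
  split=> [|Qh].
    by rewrite -[h](subKr g); apply: ideal_setB => //; apply: inQP.
  by apply: nQg => i; rewrite -[g](subrK h) coefD; apply: ideal_setD.
have inQ_small f1 : P f1 -> (size f1 < size g)%N -> inQ f1.
  move=> Pf1 lt_f1; apply: contrapT => nQf1.
  by have /min_g := conj Pf1 nQf1; rewrite leqNgt lt_f1.
pose S := [set r | ~ P r /\ exists w v, P v /\ r = w * s + v].
have Ss : S s.
  split=> //; exists 1, 0; rewrite mul1r addr0; split=> //; exact: ideal_set0.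
have SP r a q : S r -> P q -> ~ P (a * r + q) -> S (a * r + q).
  move=> [_ [w [v [Pv ->]]]] Pq nP; split=> //.
  exists (a * w), (a * v + q); rewrite mulrDr mulrA addrA; split=> //.
  by apply: ideal_setD => //; apply: ideal_setM.
have [r Sr min_r] := minimal_size Ss.
have nPr : ~ P r by case: Sr.
have r0 : r != 0 by apply: contraPneq nPr => ->; apply; apply: ideal_set0.
have min_rP r' a q : P q -> r' = a * r + q -> (size r' < size r)%N -> P r'.
  move=> Pq r'E lt_r'; apply: contrapT; rewrite r'E => /(SP _ _ _ Sr Pq)/min_r.
  by rewrite -r'E leqNgt lt_r'.
have nQlr : ~ Q (lead_coef r).
  move=> /truncate/(_ r0)[h lt_hr Qrh]; apply: nPr.
  rewrite -[r](subrK h); apply: ideal_setD; rewrite //; first exact: inQP.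
  apply: (min_rP h 1 (- (r - h))) => //; last by rewrite mul1r subKr.
  by apply: ideal_setN => //; apply: inQP.
(* Otherwise pseudo-division of r by g leaves a remainder shorter than r; by minimality it lies in
   P, and then so does r. *)
have lt_rg : (size r < size g)%N.
  rewrite ltnNge; apply/negP => le_gr.
  have [k [q [r' [E lt_r'g]]]] := pdiv r g0.
  have Pr' : P r'.
    apply: (min_rP r' (lead_coef g ^+ k)%:P (- (q * g))).
    - by apply: ideal_setN => //; apply: ideal_setM.
    - by rewrite E addrC addKr.
    - exact: leq_trans le_gr.
  apply/nPr/(PM_lead (k := k) nQlg); rewrite E.
  by apply: ideal_setD => //; apply: ideal_setM.
have le_r1 : (size r <= 1)%N.
  rewrite leqNgt; apply/negP => lt1r.
  have [k [q [r' [E lt_r'r]]]] := pdiv g r0.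
  have Pr' : P r'.
    apply: (min_rP r' (- q) ((lead_coef r ^+ k)%:P * g)) => //.
      exact: ideal_setM.
    by rewrite E mulNr addKr.
  have Pqr : P (q * r).
    by apply: (ideal_set_cancel hI _ Pr'); rewrite -E; apply: ideal_setM.
  have Pq : P q by case: (prime_mul hP Pqr).
  have Qqq : inQ (q - q) by move=> i; rewrite subrr coef0; apply: ideal_set0.
  (* Shortening q modulo Q to h puts the leading coefficient of h outside Q. As h lies in P it is at
     least as long as g, so h r is longer than g, and its top coefficient, a product of two elements
     outside Q, would lie in Q. If h = 0, the leading coefficient of g falls in Q instead. *)
  have [h Qqh min_h] := @minimal_size [set h | inQ (q - h)] q Qqq.
  have E' : (lead_coef r ^+ k)%:P * g = h * r + r' + (q - h) * r.
    by rewrite E mulrBl addrAC [h * r + _]addrC subrK.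
  have Qqhr i : Q ((q - h) * r)`_i.
    by rewrite coefM; apply: ideal_set_sum => // j _; apply: ideal_setMr.
  have [h0|h0] := eqVneq h 0.
    have : Q (lead_coef r ^+ k * lead_coef g).
      rewrite [lead_coef g]lead_coefE -coefCM E' {1}h0 mul0r add0r coefD [r'`__]nth_default; first by rewrite add0r; apply: Qqhr.
      by rewrite -ltnS prednK ?size_poly_gt0 // (leq_trans lt_r'r) // ltnW.
    by case/(prime_mul hQ) => [/(prime_exp hQ)|].
  have nQlh : ~ Q (lead_coef h).
    move=> /truncate/(_ h0)[h' lt_h' Qhh'].
    have /min_h : inQ (q - h').
      by move=> i; rewrite -(subrK h q) -addrA coefD; apply: ideal_setD.
    by rewrite leqNgt lt_h'.
  have Ph : P h.
    by rewrite -[h](subKr q); apply: ideal_setB => //; apply: inQP.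
  have le_gh : (size g <= size h)%N.
    by apply: min_g; split=> // Qh; apply: nQlh; apply: Qh.
  have : Q (lead_coef h * lead_coef r).
    rewrite mul_lead_coef; set i := _.-2.
    have le_gi : (size g <= i)%N.
      by rewrite /i -subn2 -addnBA // (leq_trans le_gh) // leq_addr.
    have := congr1 (fun f : {poly B} => f`_i) E'.
    rewrite /= coefCM. rewrite [g`_i]nth_default //. rewrite mulr0 !coefD [r'`__]nth_default; last first.
      by rewrite (leq_trans (ltnW lt_r'r)) // (leq_trans (ltnW lt_rg)).
    rewrite addr0 => /esym/eqP; rewrite addr_eq0 => /eqP ->.
    exact: ideal_setN.
  by case/(prime_mul hQ).
have [c rE] : exists c, r = c%:P by exists r`_0; apply: size1_polyC.
have nQc : ~ Q c by move: nPr; rewrite rE.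
(* The factor [lead_coef g] keeps the degree of g under phi, so that a root exists; the factor c
   makes s nonzero there. *)
exists (c * lead_coef g) => [/(prime_mul hQ)[]//|K phi phiQ].
rewrite rmorphM mulf_eq0 negb_or => /andP[phic phig].
have sz_phig : size (map_poly phi g) = size g by rewrite size_map_poly_id0.
have /closed_rootP[t /rootP gt0] : size (map_poly phi g) != 1%N.
  apply/eqP; rewrite sz_phig => g1; apply: nQlg.
  have /size1_polyC gE : (size g <= 1)%N by rewrite g1.
  by rewrite /Q /= gE lead_coefC -gE.
have phi0 f1 : inQ f1 -> map_poly phi f1 = 0.
  by move=> Qf1; apply/polyP => i; rewrite coef_map coef0; apply: phiQ.
have Pt f1 : P f1 -> (map_poly phi f1).[t] = 0.
  move=> Pf1; have [k [q [r' [E lt_r'g]]]] := pdiv f1 g0.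
  have /inQ_small/(_ lt_r'g)/phi0 r'0 : P r'.
    suff -> : r' = (lead_coef g ^+ k)%:P * f1 - q * g.
      by apply: ideal_setB => //; apply: ideal_setM.
    by rewrite E addrC addKr.
  have := congr1 (fun f => (map_poly phi f).[t]) E.
  rewrite rmorphD !rmorphM /= r'0 addr0 !hornerM gt0 mulr0 map_polyC /= hornerC.
  by move/eqP; rewrite mulf_eq0 rmorphXn expf_eq0 (negPf phig) andbF => /eqP.
exists t; split=> //; case: Sr => _ [w [v [Pv]]]; rewrite rE => E.
have := congr1 (fun f => (map_poly phi f).[t]) E.
rewrite map_polyC hornerC rmorphD rmorphM /= hornerD hornerM (Pt v Pv) addr0 => phicE.
by apply: contraNneq phic => st0; rewrite /= phicE st0 mulr0.
Qed.

End PrimeExtension.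

(** * Polynomial rings: morphisms, derivations, splitting off a variable *)

Lemma mpoly_ring_ind n (R : comNzRingType) (T : {mpoly R[n]} -> Prop) :
  (forall c, T c%:MP) -> (forall i, T 'X_i) ->
  (forall p q, T p -> T q -> T (p + q)) ->
  (forall p q, T p -> T q -> T (p * q)) -> forall q, T q.
Proof.
move=> TC TX TD TM; elim/mpolyind => [|c m q _ _ Tq].
  by rewrite -mpolyC0; apply: TC.
apply: TD => //; rewrite -mul_mpolyC mpolyXE_id; apply: (TM) => //.
elim/big_ind: _ => [||i _]; [exact: (TC 1)|exact: TM|].
by elim: (m i) => [|k IHk]; [exact: (TC 1)|rewrite exprS; apply: TM].
Qed.

Lemma mpoly_rmorph_congr n (R S : comNzRingType) (I : set S)
    (phi psi : {rmorphism {mpoly R[n]} -> S}) : ideal_set I ->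
  (forall c, I (phi c%:MP - psi c%:MP)) -> (forall i, I (phi 'X_i - psi 'X_i)) ->
  forall q, I (phi q - psi q).
Proof.
move=> hI IC IX; elim/mpoly_ring_ind => // p q Ip Iq.
  by rewrite !rmorphD opprD addrACA; apply: ideal_setD.
rewrite !rmorphM mulrBB.
by apply: ideal_setD => //; [apply: ideal_setMr|apply: ideal_setM].
Qed.

Lemma mderivXU (R : comNzRingType) n (i j : 'I_n) :
  ('X_i : {mpoly R[n]})^`M(j) = (i == j)%:R.
Proof.
rewrite mderivX mnm1E; case: eqP => [->|_]; last by rewrite scale0r.
have -> : (U_(j) - U_(j) = 0 :> 'X_{1..n})%MM by apply/mnmP => k; rewrite mnmBE mnm0E subnn.
by rewrite scale1r mpolyX0.
Qed.

Lemma derivation_mmap n (R S : comNzRingType) (f : {rmorphism R -> S})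
    (h : 'I_n -> S) (d : S -> S) :
  (forall a b, d (a + b) = d a + d b) ->
  (forall a b, d (a * b) = d a * b + a * d b) ->
  (forall c, d (f c) = 0) ->
  forall q, d (mmap f h q) = \sum_k mmap f h q^`M(k) * d (h k).
Proof.
move=> dD dM dC; elim/mpoly_ring_ind => [c|i|p q Ep Eq|p q Ep Eq].
- by rewrite mmapC dC big1 // => k _; rewrite mderivC rmorph0 mul0r.
- rewrite mmapX mmap1U (bigD1 i) //= big1 => [|k /negPf ki]; last first.
    by rewrite mderivXU eq_sym ki rmorph0 mul0r.
  by rewrite mderivXU eqxx rmorph1 mul1r addr0.
- rewrite rmorphD dD Ep Eq -big_split; apply: eq_bigr => k _.
  by rewrite mderivD rmorphD mulrDl.
- rewrite rmorphM dM Ep Eq mulr_suml mulr_sumr -big_split; apply: eq_bigr => k _.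
  by rewrite mderivM rmorphD !rmorphM mulrDl mulrAC mulrA.
Qed.

Section MpolyMorphism.
Variables (n : nat) (R S : comNzRingType).

Lemma mpoly_rmorph_eq (phi psi : {rmorphism {mpoly R[n]} -> S}) :
  (forall c, phi c%:MP = psi c%:MP) -> (forall i, phi 'X_i = psi 'X_i) ->
  phi =1 psi.
Proof.
move=> eqC eqX q; rewrite [q]mpolyE !rmorph_sum /=; apply: eq_bigr => m _.
rewrite -mul_mpolyC !rmorphM eqC mpolyXE_id !rmorph_prod; congr (_ * _).
by apply: eq_bigr => i _; rewrite !rmorphXn eqX.
Qed.

Lemma mmapXU (f : {rmorphism R -> S}) (h : 'I_n -> S) i : mmap f h 'X_i = h i.
Proof. by rewrite mmapX mmap1U. Qed.

Lemma mmap_eq (f : R -> S) (h h' : 'I_n -> S) q :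
  h =1 h' -> mmap f h q = mmap f h' q.
Proof. by move=> /funext ->. Qed.

End MpolyMorphism.

Section LastVariable.
Variables (n : nat) (R : comNzRingType).

Definition to_poly : {rmorphism {mpoly R[n.+1]} -> {poly {mpoly R[n]}}} :=
  mmap (polyC \o @mpolyC n R)
    (fun i => if unlift ord_max i is Some j then ('X_j)%:P else 'X).

Definition of_poly : {rmorphism {poly {mpoly R[n]}} -> {mpoly R[n.+1]}} :=
  horner_eval 'X_ord_max \o
    map_poly (mmap (@mpolyC n.+1 R) (fun j => 'X_(lift ord_max j))).

Lemma to_polyK : cancel to_poly of_poly.
Proof.
apply: (mpoly_rmorph_eq (phi := of_poly \o to_poly) (psi := idfun)) => [c|i] /=.
  by rewrite mmapC /= map_polyC /= mmapC horner_evalE hornerC.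
rewrite mmapXU; case: unliftP => [j|] ->; last first.
  by rewrite map_polyX horner_evalE hornerX.
by rewrite map_polyC /= mmapXU horner_evalE hornerC.
Qed.

Definition ext_point (K : Type) (a : 'I_n -> K) (t : K) (i : 'I_n.+1) : K :=
  if unlift ord_max i is Some j then a j else t.

Lemma horner_to_poly (K : comNzRingType) (iota : {rmorphism R -> K})
    (a : 'I_n -> K) (t : K) (q : {mpoly R[n.+1]}) :
  (map_poly (mmap iota a) (to_poly q)).[t] = mmap iota (ext_point a t) q.
Proof.
pose phi := horner_eval t \o (map_poly (mmap iota a) \o to_poly).
rewrite -[LHS]/(phi q); apply: mpoly_rmorph_eq => [c|i] /=.
  by rewrite !mmapC /= map_polyC /= mmapC horner_evalE hornerC.
rewrite !mmapXU /ext_point; case: unlift => [j|].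
  by rewrite map_polyC /= mmapXU horner_evalE hornerC.
by rewrite map_polyX horner_evalE hornerX.
Qed.

End LastVariable.

(** Used with R = K for the geometry, and with R = Q[A] inside the closure of its fraction field for
    the generic matrix. The element s carries the induction: the denominator produced by
    [prime_extension] is what must stay nonzero in one variable less. *)
Theorem nullstellensatz (R : comNzRingType) (K : closedFieldType)
    (iota : {rmorphism R -> K}) (n : nat) (P : set {mpoly R[n]})
    (s : {mpoly R[n]}) :
  prime_set P -> (forall c, P c%:MP <-> iota c = 0) -> ~ P s ->
  exists a : 'I_n -> K, (forall q, P q -> mmap iota a q = 0) /\
                        mmap iota a s != 0.
Proof.
elim: n P s => [|n IHn] P s hP Pc nPs.
  exists (fun i => 0); split=> [q|].
    by rewrite [q]nvar0_mpolyC mmapC => /Pc.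
  by apply/eqP; move: nPs; rewrite [s]nvar0_mpolyC mmapC => nPs /Pc.
pose P' := [set f | P (of_poly n R f)].
have hP' : prime_set P' by apply: prime_preimage.
have /(prime_extension hP')[d nQd ext] : ~ P' (to_poly n R s).
  by rewrite /P' /mkset to_polyK.
have hQ : prime_set [set b | P' b%:P] by apply: prime_preimage.
have [c|a [aQ ad]] := IHn _ d hQ _ nQd.
  have E : of_poly n R (c%:MP)%:P = c%:MP.
    by rewrite /= map_polyC /= mmapC horner_evalE hornerC.
  by rewrite /P' /mkset E.
have [t [tP ts]] := ext K (mmap iota a) aQ ad.
exists (ext_point a t); split=> [q Pq|]; rewrite -horner_to_poly //.
by apply: tP; rewrite /P' /mkset to_polyK.
Qed.

Corollary meval_nonzero (K : closedFieldType) n (q : {mpoly K[n]}) :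
  q != 0 -> exists a : 'I_n -> K, q.@[a] != 0.
Proof.
move=> q0; have set0P : prime_set [set 0 : {mpoly K[n]}].
  split=> [||a b /eqP]; last by rewrite mulf_eq0 => /orP[]/eqP ->; [left|right].
    by split=> [|a b -> ->|a b ->] //=; rewrite ?addr0 ?mulr0.
  by apply/eqP; rewrite oner_eq0.
have [c||a [_ aq]] := nullstellensatz (iota := idfun) (s := q) set0P.
- by split=> [/eqP|/= ->]; rewrite ?mpolyC0 // mpolyC_eq0 => /eqP.
- by apply/eqP.
by exists a.
Qed.

(** * Hilbert's basis theorem and Krull's intersection theorem *)

(** Each chosen index minimizes u on the tail that starts just after the previous one. *)
Lemma nondecreasing_subsequence (u : nat -> nat) :
  exists phi : nat -> nat, {homo phi : i j / (i < j)%N} /\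
    {homo u \o phi : i j / (i <= j)%N}.
Proof.
have minP N : exists j, (N <= j)%N /\ forall l, (N <= l)%N -> (u j <= u l)%N.
  pose v c := `[< exists2 j, (N <= j)%N & u j = c >].
  have ex_v : exists c, v c by exists (u N); apply/asboolP; exists N.
  case: (ex_minnP ex_v) => c /asboolP[j leNj <-] min_c.
  by exists j; split=> // l leNl; apply: min_c; apply/asboolP; exists l.
have [g gP] := choice minP.
pose phi := fix phi k := if k is k'.+1 then g (phi k').+1 else g 0%N.
have phi_lt k : (phi k < phi k.+1)%N by case: (gP (phi k).+1).
exists phi; split; first exact: homo_ltn ltn_trans phi_lt.
apply: (homo_leq (leqnn) leq_trans) => k /=.
case: k => [|k]; apply: (gP _).2 => //.
by rewrite ltnW // (leq_ltn_trans (phi_lt k)).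
Qed.

(** Nondecreasing subsequences are extracted for one coordinate after the other. *)
Lemma dickson n (f : nat -> 'X_{1..n}) :
  exists i j, (i < j)%N /\ (f i <= f j)%MM.
Proof.
suff [phi [phi_lt phi_le]] : exists phi : nat -> nat,
    {homo phi : i j / (i < j)%N} /\
    forall c, c \in enum 'I_n -> {homo (fun k => f (phi k) c) : i j / (i <= j)%N}.
  exists (phi 0%N), (phi 1%N); split; first exact: phi_lt.
  by apply/mnm_lepP => c; apply: (phi_le c); rewrite ?mem_enum.
elim: (enum 'I_n) => [|c cs [phi [phi_lt phi_le]]]; first by exists id; split.
have [psi [psi_lt psi_le]] := nondecreasing_subsequence (fun k => f (phi k) c).
exists (phi \o psi); split=> [i j /psi_lt/phi_lt//|d].
rewrite inE => /predU1P[->|/phi_le d_le] i j le_ij; first exact: (psi_le i j).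
apply: d_le; move: le_ij; rewrite leq_eqVlt => /predU1P[->//|/psi_lt].
exact: ltnW.
Qed.

Section HilbertBasis.
Variables (K : fieldType) (n : nat).
Implicit Types (I : set {mpoly K[n]}).

Lemma mlead_reduction (f g : {mpoly K[n]}) :
  f != 0 -> g != 0 -> (mlead f <= mlead g)%MM ->
  exists c : {mpoly K[n]}, g - c * f = 0 \/ (mlead (g - c * f) < mlead g)%O.
Proof.
move=> f0 g0 le_fg; pose m := (mlead g - mlead f)%MM.
pose a := mleadc g / mleadc f.
have a0 : a != 0 by rewrite mulf_neq0 ?invr_eq0 ?mleadc_eq0.
have X0 : 'X_[m] != 0 :> {mpoly K[n]}.
  by apply/eqP => /(congr1 (mcoeff m)) /eqP; rewrite mcoeffX eqxx mcoeff0 oner_eq0.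
exists (a *: 'X_[m]); set c := a *: _.
have c0 : c != 0 by rewrite mscalerI negb_or a0.
have leadcf : mlead (c * f) = mlead g.
  by rewrite mleadM // mleadZ // mleadXm submK.
have coef_cf : (c * f)@_(mlead g) = mleadc g.
  by rewrite -(submK le_fg) mulrC -scalerAr mcoeffZ [_@__]mcoeffMX submK // divfK ?mleadc_eq0.
have [->|h0] := eqVneq (g - c * f) 0; [by left|right].
rewrite lt_neqAle; apply/andP; split; last first.
  by apply: le_trans (mleadB_le _ _) _; rewrite leadcf joinxx.
apply: contraNneq h0 => E; rewrite -mleadc_eq0 E mcoeffB coef_cf subrr //.
Qed.

(** Otherwise elements of I with least leading monomial outside the ideal of their predecessors can
    be chosen forever. By Dickson's lemma one leading monomial divides a later one, and reducing the
    later element contradicts its minimality. *)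
Theorem hilbert_basis I : ideal_set I ->
  exists s, (forall a, a \in s -> I a) /\ I `<=` gen_ideal s.
Proof.
move=> hI; apply: contrapT => nfg.
pose good s f := [/\ I f, ~ gen_ideal s f &
  forall h, I h -> ~ gen_ideal s h -> (mlead f <= mlead h)%O].
(* The hypothesis on s stays under the existential so that [choice] gives a total function. *)
have ex_good s : exists f, (forall a, a \in s -> I a) -> good s f.
  have [sI|nsI] := pselect (forall a, a \in s -> I a); last by exists 0.
  have [f [If nsf]] : exists f, I f /\ ~ gen_ideal s f.
    apply: contrapT => nex; apply: nfg; exists s; split=> // f If.
    by apply: contrapT => nsf; apply: nex; exists f.
  move fm : (mlead f) => m.
  elim/(@ltmwf n): m f fm If nsf => m IHm f fm If nsf.
  have [[h [Ih nsh lt_h]]|nex] :=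
    pselect (exists h, [/\ I h, ~ gen_ideal s h & (mlead h < m)%O]).
    exact: (IHm _ lt_h h).
  exists f => _; split=> // h Ih nsh; rewrite leNgt; apply/negP => lt_h.
  by apply: nex; exists h; rewrite -fm.
have [G GP] := choice ex_good.
pose L := fix L k := if k is k'.+1 then rcons (L k') (G (L k')) else [::].
have LI k : forall a, a \in L k -> I a.
  elim: k => [//|k IHk] a; rewrite /= mem_rcons inE => /predU1P[->|/IHk//].
  by case: (GP _ IHk).
have GL i j : (i < j)%N -> G (L i) \in L j.
  elim: j => // j IHj; rewrite ltnS leq_eqVlt => /predU1P[->|/IHj] /=.
    by rewrite mem_rcons mem_head.
  by rewrite mem_rcons inE orbC => ->.
have G0 k : G (L k) != 0.
  apply/eqP => Gk; have [_ nG _] := GP _ (LI k); apply: nG; rewrite Gk.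
  exact: ideal_set0 (gen_ideal_ideal _).
have [i [j [lt_ij le_m]]] := dickson (fun k => mlead (G (L k))).
have [c lt_h] := mlead_reduction (G0 i) (G0 j) le_m.
have [[Ij nGj minj] [Ii _ _]] := (GP _ (LI j), GP _ (LI i)).
set h := _ - _ in lt_h.
have Lcf : gen_ideal (L j) (c * G (L i)).
  by apply: (ideal_setM (gen_ideal_ideal _)); apply/gen_ideal_mem/GL.
have nsh : ~ gen_ideal (L j) h.
  move=> Lh; apply: nGj; rewrite -[G (L j)](subrK (c * G (L i))).
  by apply: (ideal_setD (gen_ideal_ideal _)).
have Ih : I h by apply: ideal_setB => //; apply: ideal_setM.
case: lt_h => [h0|]; last by rewrite ltNge minj.
by apply: nsh; rewrite h0; apply: ideal_set0 (gen_ideal_ideal _).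
Qed.

Corollary ascending_chain (a : nat -> {mpoly K[n]}) :
  exists N, forall k, gen_ideal (mkseq a N) (a k).
Proof.
pose I := [set q | exists N, gen_ideal (mkseq a N) q].
have mono M N : (M <= N)%N -> gen_ideal (mkseq a M) `<=` gen_ideal (mkseq a N).
  move=> leMN; apply: gen_ideal_sub (gen_ideal_ideal _) _ => _ /mapP[i lti ->].
  apply/gen_ideal_mem/map_f; move: lti; rewrite !mem_iota /= !add0n => lti.
  exact: leq_trans leMN.
have hI : ideal_set I.
  split=> [|q r [M qM] [N rN]|q r [N rN]].
  - by exists 0%N; apply: ideal_set0 (gen_ideal_ideal _).
  - exists (maxn M N); apply: (ideal_setD (gen_ideal_ideal _)).
      by apply: mono qM; apply: leq_maxl.
    by apply: mono rN; apply: leq_maxr.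
  - by exists N; apply: (ideal_setM (gen_ideal_ideal _)).
have [s [sI Is]] := hilbert_basis hI.
have [N sN] : exists N, forall q, q \in s -> gen_ideal (mkseq a N) q.
  elim: s {Is} sI => [|q s IHs] sI; first by exists 0%N.
  have [|N sN] := IHs; first by move=> r sr; apply: sI; rewrite inE sr orbT.
  have [M qM] := sI q (mem_head _ _).
  exists (maxn M N) => r; rewrite inE => /predU1P[->|/sN rN].
    by apply: mono qM; apply: leq_maxl.
  by apply: mono rN; apply: leq_maxr.
exists N => k; apply: (gen_ideal_sub (gen_ideal_ideal _) sN); apply: Is.
exists k.+1; apply/gen_ideal_mem/map_f; rewrite mem_iota //=.
Qed.

End HilbertBasis.

(** * Powers of the maximal ideal of a point, and Krull's theorem *)

Section MaximalPowers.
Variables (K : fieldType) (n : nat).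
Implicit Types (x : 'I_n -> K) (p q : {mpoly K[n]}).

Fixpoint max_pow x (N : nat) : set {mpoly K[n]} :=
  if N is N'.+1 then
    [set q | exists c : 'I_n -> {mpoly K[n]},
       (forall j, max_pow x N' (c j)) /\ q = \sum_j c j * ('X_j - (x j)%:MP)]
  else setT.

Lemma max_pow_ideal x N : ideal_set (max_pow x N).
Proof.
elim: N => [//|N IHN]; split=> [|_ _ [c [cN ->]] [d [dN ->]]|a _ [c [cN ->]]].
- exists (fun=> 0); split=> [j|]; first exact: (ideal_set0 IHN).
  by rewrite big1 // => j _; rewrite mul0r.
- exists (fun j => c j + d j); split=> [j|]; first exact: (ideal_setD IHN (cN j) (dN j)).
  by rewrite -big_split; apply: eq_bigr => j _; rewrite mulrDl.
- exists (fun j => a * c j); split=> [j|]; first exact: (ideal_setM IHN _ (cN j)).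
  by rewrite mulr_sumr; apply: eq_bigr => j _; rewrite mulrA.
Qed.

Lemma max_powS x N : max_pow x N.+1 `<=` max_pow x N.
Proof.
move=> q [c [cN ->]]; apply: (ideal_set_sum _ (max_pow_ideal x N)) => j _.
exact: (ideal_setMr _ (max_pow_ideal x N) (cN j)).
Qed.

Lemma max_pow_le x M N : (M <= N)%N -> max_pow x N `<=` max_pow x M.
Proof.
move=> /subnK <-; elim: (N - M)%N => // k IHk q /max_powS; exact: IHk.
Qed.

Lemma max_powM x M N p q :
  max_pow x M p -> max_pow x N q -> max_pow x (M + N) (p * q).
Proof.
elim: M p => [|M IHM] p; first by move=> _; apply: (ideal_setM (max_pow_ideal _ _)).
move=> [c [cM ->]] qN; rewrite addSn; exists (fun j => c j * q).
split=> [j|]; first exact: (IHM _ (cM j) qN).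
by rewrite mulr_suml; apply: eq_bigr => j _; rewrite mulrAC.
Qed.

Lemma max_pow_var x j : max_pow x 1 ('X_j - (x j)%:MP).
Proof.
exists (fun i => (i == j)%:R); split=> //.
rewrite (bigD1 j) //= eqxx mul1r big1 ?addr0 // => i /negPf ->.
by rewrite mul0r.
Qed.

Lemma max_pow_meval x q : max_pow x 1 (q - (q.@[x])%:MP).
Proof.
have hI := max_pow_ideal x 1.
apply: (mpoly_rmorph_congr (phi := idfun) (psi := @mpolyC n K \o meval x) hI)
  => [c|j] /=.
  by rewrite mevalC subrr; apply: (ideal_set0 hI).
by rewrite mevalXU; apply: max_pow_var.
Qed.

Lemma max_pow1P x q : max_pow x 1 q <-> q.@[x] = 0.
Proof.
split=> [[c [_ ->]]|qx]; last by have := max_pow_meval x q; rewrite qx mpolyC0 subr0.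
rewrite rmorph_sum big1 //= => j _.
by rewrite mevalM mevalB mevalXU mevalC subrr mulr0.
Qed.

(** Differentiating the sum of the c_i (X_i - x_i) at x returns c_j(x); this is how gradients enter
    the adic filtration. *)
Lemma max_pow2P x q :
  max_pow x 2 q <-> q.@[x] = 0 /\ forall j, q^`M(j).@[x] = 0.
Proof.
have dE (c : 'I_n -> {mpoly K[n]}) j :
    (\sum_i c i * ('X_i - (x i)%:MP))^`M(j).@[x] = (c j).@[x].
  rewrite (raddf_sum (mderiv j)) (raddf_sum (meval x)) (bigD1 j) //= big1 => [|i /negPf ij].
    rewrite mderivM mderivB mderivXU mderivC subr0 eqxx mulr1 mevalD mevalM.
    by rewrite mevalB mevalXU mevalC subrr mulr0 add0r addr0.
  rewrite mderivM mderivB mderivXU mderivC subr0 ij mulr0 addr0.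
  by rewrite mevalM mevalB mevalXU mevalC subrr mulr0.
split=> [q2|[/max_pow1P[c [_ ->]] dq]].
  split; first by apply/max_pow1P; apply: (@max_powS x 1).
  by case: q2 => c [c1 ->] j; rewrite dE; apply/max_pow1P; apply: c1.
by exists c; split=> // j; apply/max_pow1P; rewrite -dE.
Qed.

End MaximalPowers.

Lemma max_pow_rmorph (K : fieldType) (m n : nat) (x : 'I_m -> K) (y : 'I_n -> K)
    (phi : {rmorphism {mpoly K[m]} -> {mpoly K[n]}}) N q :
  (forall j, (phi ('X_j - (x j)%:MP)).@[y] = 0) ->
  max_pow x N q -> max_pow y N (phi q).
Proof.
move=> phi0; elim: N q => [//|N IHN] q [c [cN ->]].
rewrite rmorph_sum; apply: (ideal_set_sum _ (max_pow_ideal _ _)) => j _.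
 rewrite rmorphM -addn1; apply: max_powM; first exact: (IHN _ (cN j)).
exact/max_pow1P.
Qed.

Section Krull.
Variables (K : fieldType) (n : nat) (x : 'I_n -> K).

(* Onto the Rees algebra of the maximal ideal at x. *)
Let theta : {rmorphism {mpoly K[n + n]} -> {poly {mpoly K[n]}}} :=
  mmap (polyC \o @mpolyC n K) (fun i => match split i with
    | inl j => ('X_j)%:P | inr j => ('X_j - (x j)%:MP)%:P * 'X end).

Let theta_surj N v : max_pow x N v -> exists F, theta F = v%:P * 'X^N.
Proof.
elim: N v => [|N IHN] v.
  move=> _; exists (mmap (@mpolyC (n + n) K) (fun j => 'X_(lshift n j)) v).
  rewrite expr0 mulr1; pose psi := mmap (@mpolyC (n + n) K) (fun j : 'I_n => 'X_(lshift n j)).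
  apply: (mpoly_rmorph_eq (phi := theta \o psi) (psi := polyC)) => [c|i] /=.
    by rewrite !mmapC.
  by rewrite !mmapXU (unsplitK (inl i)).
move=> [c [cN ->]]; have [F FE] := choice (fun j => IHN (c j) (cN j)).
exists (\sum_j F j * 'X_(rshift n j)).
rewrite !rmorph_sum /= mulr_suml; apply: eq_bigr => j _.
rewrite rmorphM FE /= mmapXU (unsplitK (inr j)) polyCM exprSr.
by rewrite mulrACA.
Qed.

(** The factors X_j - x_j that accompany lambda vanish at x, so only the coefficient of lambda^0
    survives evaluation. *)
Let theta_eval F d : (0 < d)%N -> ((theta F)`_d).@[x] = 0.
Proof.
pose ev := [eta @meval (n + n) K (fun i => match split i with inl j => x j | inr _ => 0 end)].
have E : map_poly (meval x) (theta F) = (ev F)%:P.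
  apply: (mpoly_rmorph_eq (phi := map_poly (meval x) \o theta)
    (psi := polyC \o ev)) => [c|i] /=.
    by rewrite mmapC /= map_polyC /= !mevalC.
  rewrite mmapXU mevalXU; case: split => j; first by rewrite map_polyC /= mevalXU.
  by rewrite rmorphM /= map_polyC /= mevalB mevalXU mevalC subrr mul0r.
by move=> d0; rewrite -coef_map E coefC; case: d d0.
Qed.

(* Write q = a_N + v_N with v_N in m_x^N.  By the Hilbert basis theorem applied
   to the v_N lambda^N in the Rees algebra, some v_N is a combination of the
   earlier v_k with coefficients in m_x^(N - k), whence (1 - u) q is in I for
   some u in m_x. *)
Theorem krull_intersection (I : set {mpoly K[n]}) q : ideal_set I ->
  (forall N, exists2 a, I a & max_pow x N (q - a)) ->
  exists2 b : {mpoly K[n]}, b.@[x] != 0 & I (b * q).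
Proof.
move=> hI qI.
have /choice[F FE] N : exists F, exists2 a, I a & theta F = (q - a)%:P * 'X^N.
  by have [a Ia /theta_surj[F FE]] := qI N; exists F, a.
have [N /(_ N)[c FN]] := ascending_chain F.
have ltN (i : 'I_(size (mkseq F N))) : (i < N)%N.
  by apply: leq_trans (ltn_ord i) _; rewrite size_mkseq.
(* In degree N the relation for F_N expresses v_N = q - a_N through the v_i = q - a_i, with the
   coefficients of [theta (c i)] in degree N - i > 0, which vanish at x. Collecting the terms in q
   gives (1 - u) q. *)
pose u := \sum_(i < size (mkseq F N)) (theta (c i))`_(N - i).
exists (1 - u).
  rewrite mevalB meval1 rmorph_sum /= big1 ?subr0 ?oner_eq0 // => i _.
  by rewrite theta_eval // subn_gt0.
have [a Ia FNE] := FE N; rewrite mulrBl mul1r.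
have : q - a = \sum_(i < size (mkseq F N)) (theta (c i))`_(N - i) *
   (q - sval (cid2 (FE i))).
  have := congr1 (fun f => (theta f)`_N) FN.
  rewrite FNE coefMXn ltnn subnn coefC /= => ->.
  rewrite rmorph_sum /= coef_sum; apply: eq_bigr => i _.
  rewrite nth_mkseq // rmorphM /=; case: cid2 => b Ib /= ->.
  by rewrite mulrA coefMXn ltnNge ltnW //= coefMC.
move=> /(canRL (subrK a)) E.
have -> : q - u * q = a - \sum_(i < size (mkseq F N)) (theta (c i))`_(N - i) *
   sval (cid2 (FE i)).
  rewrite {1}E mulr_suml addrAC addrC; congr (a + _).
  by rewrite -sumrB -sumrN; apply: eq_bigr => i _; rewrite mulrBr addrAC subrr sub0r.
apply: ideal_setB => //; apply: ideal_set_sum => // i _; apply: ideal_setM => //.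
by case: cid2.
Qed.

End Krull.

(** * Local coordinates *)

Lemma coefM_lowest (R : nzRingType) (f g : {poly R}) a b :
  (forall d, (d < a)%N -> f`_d = 0) -> (forall d, (d < b)%N -> g`_d = 0) ->
  (f * g)`_(a + b) = f`_a * g`_b.
Proof.
move=> f0 g0; have lt_a : (a < (a + b).+1)%N by rewrite ltnS leq_addr.
rewrite coefM (bigD1 (Ordinal lt_a)) //= addKn big1 ?addr0 // => i /eqP ia.
have [/f0->|] := ltnP i a; first by rewrite mul0r.
rewrite leq_eqVlt => /predU1P[E|ltai]; first by case: ia; apply: val_inj.
by rewrite (g0 (a + b - i)%N) ?mulr0 // ltn_subLR ?ltn_add2r // -ltnS.
Qed.

Section OrderAtOrigin.
Variables (K : fieldType) (n : nat).
Implicit Types (p q : {mpoly K[n]}).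

Let origin : 'I_n -> K := fun=> 0.

(* q(lambda X), whose coefficients are the homogeneous components of q. *)
Let dil : {rmorphism {mpoly K[n]} -> {poly {mpoly K[n]}}} :=
  mmap (polyC \o @mpolyC n K) (fun j => ('X_j)%:P * 'X).

Let dilX m : dil 'X_[m] = 'X_[m] *: 'X^(mdeg m).
Proof.
rewrite /= mmapX /mmap1 mdegE -mul_polyC -prodrXr mpolyXE_id rmorph_prod.
by rewrite -big_split; apply: eq_bigr => i _; rewrite /= exprMn rmorphXn.
Qed.

Let dil1 q : (dil q).[1] = q.
Proof.
apply: (mpoly_rmorph_eq (phi := horner_eval 1 \o dil) (psi := idfun)) => [c|i] /=.
  by rewrite mmapC horner_evalE hornerC.
by rewrite mmapXU horner_evalE hornerM hornerC hornerX mulr1.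
Qed.

Let dil_pow q d : max_pow origin d (dil q)`_d.
Proof.
have hI := max_pow_ideal origin d.
elim/mpolyind: q => [|c m q _ _ IHq].
  by rewrite rmorph0 coef0; apply: (ideal_set0 hI).
rewrite (rmorphD dil) coefD; apply: (ideal_setD hI) IHq.
have -> : dil (c *: 'X_[m]) = (c%:MP)%:P * dil 'X_[m].
  by rewrite -mul_mpolyC (rmorphM dil) /= mmapC.
rewrite dilX coefCM; apply: (ideal_setM hI).
rewrite coefZ coefXn; case: eqP => [->|_]; last first.
  by rewrite mulr0; apply: (ideal_set0 hI).
rewrite mulr1 mdegE mpolyXE_id; elim/big_rec2: _ => [//|i k f _ fk].
apply: max_powM => //; elim: (m i) => [//|e IHe].
rewrite exprS -add1n; apply: max_powM => //.
by have := max_pow_var origin i; rewrite /origin mpolyC0 subr0.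
Qed.

Lemma max_pow_originP N q :
  max_pow origin N q <-> forall d, (d < N)%N -> (dil q)`_d = 0.
Proof.
split=> [qN|q0].
  suff [g ->] : exists g, dil q = g * 'X^N by move=> d ltd; rewrite coefMXn ltd.
  elim: N q qN => [|N IHN] q; first by exists (dil q); rewrite mulr1.
  move=> [c [cN ->]]; have [g gE] := choice (fun j => IHN _ (cN j)).
  exists (\sum_j g j * ('X_j)%:P); rewrite rmorph_sum mulr_suml.
  apply: eq_bigr => j _; rewrite rmorphM gE /origin mpolyC0 subr0 /= mmapXU.
  by rewrite mulrACA -exprSr.
rewrite -(dil1 q) horner_coef; apply: (ideal_set_sum _ (max_pow_ideal _ _)) => d _.
rewrite expr1n mulr1; have [ltd|leNd] := ltnP d N.
  by rewrite q0 //; apply: (ideal_set0 (max_pow_ideal _ _)).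
exact: max_pow_le leNd _ (dil_pow _ _).
Qed.

(** The lowest homogeneous components of p and q have a nonzero product, so orders at the origin
    add. The primality of the local ideals comes from here. *)
Lemma max_pow_origin_prime M N p q :
  max_pow origin (M + N) (p * q) -> max_pow origin M p \/ max_pow origin N q.
Proof.
move=> /max_pow_originP pq0.
have ex_min L f : ~ max_pow origin L f -> exists a, [/\ (a < L)%N,
    (dil f)`_a != 0 & forall d, (d < a)%N -> (dil f)`_d = 0].
  move=> /max_pow_originP nf; have ex_a : exists a, (a < L)%N && ((dil f)`_a != 0).
    apply: contrapT => nex; apply: nf => d ltd; apply/eqP; apply: contrapT => /negP fd.
    by apply: nex; exists d; rewrite ltd.
  case: (ex_minnP ex_a) => a /andP[lta fa] min_a; exists a; split=> // d ltd.
  apply/eqP; apply: contraTT ltd => fd; rewrite -leqNgt; have [ltL|geL] := ltnP d L.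
    by apply: min_a; rewrite ltL.
  by rewrite (leq_trans (ltnW lta)).
have [?|/ex_min[a [lta pa pmin]]] := pselect (max_pow origin M p); first by left.
have [?|/ex_min[b [ltb qb qmin]]] := pselect (max_pow origin N q); first by right.
have /eqP[] : (dil p)`_a * (dil q)`_b != 0 by rewrite mulf_neq0.
rewrite -[RHS](pq0 (a + b)%N); last by rewrite -addSn leq_add // ltnW.
by rewrite (rmorphM dil) coefM_lowest.
Qed.

Lemma max_pow_origin_inter q : (forall N, max_pow origin N q) -> q = 0.
Proof.
move=> qN; rewrite -(dil1 q) horner_coef big1 // => d _.
by have /max_pow_originP -> := qN d.+1; rewrite ?mul0r.
Qed.

End OrderAtOrigin.

Definition jacobian_mx (K : fieldType) (n r : nat) (x : 'I_n -> K)
    (h : 'I_r -> {mpoly K[n]}) : 'M[K]_(r, n) :=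
  \matrix_(k, j) (h k)^`M(j).@[x].

Definition msubst (R : comNzRingType) (n k : nat) (H : 'I_n -> {mpoly R[k]})
  (q : {mpoly R[n]}) : {mpoly R[k]} := mmap (@mpolyC k R) H q.

HB.instance Definition _ R n k H :=
  GRing.RMorphism.copy (@msubst R n k H) (mmap (@mpolyC k R) H).

Section Substitution.
Variables (R : comNzRingType) (n k : nat) (H : 'I_n -> {mpoly R[k]}).

Lemma msubstC c : msubst H c%:MP = c%:MP. Proof. exact: mmapC. Qed.

Lemma msubstX j : msubst H 'X_j = H j. Proof. exact: mmapXU. Qed.

Lemma msubstB : {morph msubst H : p q / p - q}. Proof. exact: rmorphB. Qed.

Lemma msubstD : {morph msubst H : p q / p + q}. Proof. exact: rmorphD. Qed.

Lemma msubstM : {morph msubst H : p q / p * q}. Proof. exact: rmorphM. Qed.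

Lemma msubst_sum (I : Type) (r : seq I) P (F : I -> {mpoly R[n]}) :
  msubst H (\sum_(i <- r | P i) F i) = \sum_(i <- r | P i) msubst H (F i).
Proof. exact: rmorph_sum. Qed.

Lemma meval_msubst (y : 'I_k -> R) s :
  (msubst H s).@[y] = s.@[fun j => (H j).@[y]].
Proof.
apply: (mpoly_rmorph_eq (phi := meval y \o msubst H)
  (psi := meval (fun j => (H j).@[y]))) => [c|i] /=.
  by rewrite msubstC !mevalC.
by rewrite msubstX mevalXU.
Qed.

Lemma mderiv_msubst i s :
  (msubst H s)^`M(i) = \sum_j msubst H s^`M(j) * (H j)^`M(i).
Proof.
apply: (@derivation_mmap _ _ _ (@mpolyC k R) H (mderiv i)) => [a b|a b|c].
- exact: mderivD.
- exact: mderivM.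
- exact: mderivC.
Qed.

End Substitution.

Section LocalCoordinates.
Variables (K : fieldType) (n : nat).
Notation origin := (fun _ : 'I_n => 0 : K).

Section Surjectivity.
Variables (x : 'I_n -> K) (H : 'I_n -> {mpoly K[n]}).
Hypothesis Hx : forall j, (H j).@[x] = 0.
Hypothesis JH : jacobian_mx x H \in unitmx.
Notation D := (msubst H).

Lemma local_max_pow N s : max_pow origin N s -> max_pow x N (D s).
Proof.
apply: max_pow_rmorph => j; rewrite mpolyC0 subr0.
by rewrite meval_msubst mevalXU.
Qed.

(** A row of the inverse Jacobian combines the H_k into a polynomial with the gradient of X_j at
    x. *)
Let linear_coord j : exists l : {mpoly K[n]},
  max_pow origin 1 l /\ max_pow x 2 ('X_j - (x j)%:MP - D l).
Proof.
pose B := invmx (jacobian_mx x H).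
exists (\sum_k B j k *: 'X_k); split.
  apply/max_pow1P; rewrite (raddf_sum (meval _)) big1 // => k _.
  by rewrite /= mevalZ mevalXU mulr0.
have DE : D (\sum_k B j k *: 'X_k) = \sum_k B j k *: H k.
  rewrite msubst_sum; apply: eq_bigr => k _.
  by rewrite -mul_mpolyC msubstM msubstC msubstX mul_mpolyC.
apply/max_pow2P; rewrite DE; split=> [|i].
  rewrite !mevalB mevalXU mevalC subrr sub0r (raddf_sum (meval _)) big1 ?oppr0 //.
  by move=> k _; rewrite /= mevalZ Hx mulr0.
have := congr1 (fun M : 'M[K]_n => M j i) (mulVmx JH).
rewrite !mxE => E; rewrite !mderivB mderivXU mderivC subr0 mevalB.
have -> : ((j == i)%:R : {mpoly K[n]}).@[x] = (j == i)%:R by rewrite rmorph_nat.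
rewrite -E (raddf_sum (mderiv i)) (raddf_sum (meval x)) -sumrB big1 // => k _.
by rewrite /= mderivZ mevalZ mxE subrr.
Qed.

(** Successive approximation: an element of m_x^M is matched modulo m_x^(M+1) by approximating its
    factors, the X_j - x_j by linear forms in the H_k. *)
Lemma local_surj N q : exists s, max_pow x N (q - D s).
Proof.
have hI N' := max_pow_ideal x N'.
have step M v : max_pow x M v -> exists s, max_pow x M.+1 (v - D s).
  elim: M v => [|M IHM] v.
    by move=> _; exists (v.@[x])%:MP; rewrite msubstC; apply: max_pow_meval.
  move=> [c [cM ->]]; have [s sP] := choice (fun j => IHM _ (cM j)).
  have [l lP] := choice linear_coord.
  exists (\sum_j s j * l j); rewrite msubst_sum -sumrB.
  apply: (ideal_set_sum _ (hI _)) => j _; rewrite msubstM mulrBB.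
  apply: (ideal_setD (hI _)).
    by rewrite -(addn1 M.+1); apply: max_powM (sP j) (max_pow_var _ _).
  rewrite -(addn2 M); apply: max_powM; last by case: (lP j).
  rewrite -(subKr (c j) (D (s j))).
  by apply: (ideal_setB (hI _)) (cM j) _; apply: max_powS.
elim: N q => [|N IHN] q; first by exists 0.
have [s sN] := IHN q; have [t tN] := step _ _ sN.
by exists (s + t); rewrite msubstD opprD addrA.
Qed.

End Surjectivity.

(* Surjectivity provides an approximate inverse of the coordinate change, which
   is itself surjective. *)
Lemma local_inj (x : 'I_n -> K) (H : 'I_n -> {mpoly K[n]}) N s :
  (forall j, (H j).@[x] = 0) -> jacobian_mx x H \in unitmx ->
  max_pow x N (msubst H s) -> max_pow origin N s.
Proof.
(* The order N + 2 is at least N, for the final comparison, and at least 2, so that the gradients of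
   the psi_j are determined. *)
move=> Hx JH DsN; pose M := N.+2.
have [psi psiP] := choice (fun j => local_surj Hx JH M ('X_j - (x j)%:MP)).
have psi0 j : (psi j).@[origin] = 0.
  have /max_pow1P := max_pow_le (isT : 1 <= M)%N (psiP j).
  rewrite !mevalB mevalXU mevalC subrr sub0r meval_msubst => /eqP.
  by rewrite oppr_eq0 => /eqP E; rewrite -[RHS]E; apply: meval_eq => i; rewrite Hx.
have Jpsi : jacobian_mx origin psi \in unitmx.
  suff : jacobian_mx origin psi *m jacobian_mx x H = 1%:M by case/mulmx1_unit.
  apply/matrixP => j i; rewrite !mxE.
  have /max_pow2P[_ /(_ i)] := max_pow_le (isT : 2 <= M)%N (psiP j).
  rewrite !mderivB mderivXU mderivC subr0 mevalB mderiv_msubst => /eqP.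
  rewrite subr_eq0 rmorph_nat => /eqP ->; rewrite (raddf_sum (meval x)).
  apply: eq_bigr => k _; rewrite !mxE /= mevalM meval_msubst; congr (_ * _).
  by apply: meval_eq => l; rewrite Hx.
pose e j := (x j)%:MP + psi j.
have DE q : max_pow x M (q - msubst H (msubst e q)).
  have hI := max_pow_ideal x M.
  apply: (mpoly_rmorph_congr (phi := idfun) (psi := msubst H \o msubst e) hI).
    move=> c; change (max_pow x M (c%:MP - msubst H (msubst e c%:MP))).
    by rewrite !msubstC subrr; apply: (ideal_set0 hI).
  move=> j; change (max_pow x M ('X_j - msubst H (msubst e 'X_j))).
  by rewrite msubstX msubstD msubstC opprD addrA; apply: psiP.
have Emax q : max_pow x N q -> max_pow origin N (msubst e q).
  apply: max_pow_rmorph => j.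
  change ((msubst e ('X_j - (x j)%:MP)).@[origin] = 0).
  rewrite msubstB msubstX msubstC /e addrAC subrr.
  by rewrite add0r psi0.
(* By surjectivity for psi, s agrees with [msubst e q] to order N. Substituting H in the latter
   gives back q by [DE], and agrees with [msubst H s], so q lies in m_x^N; applying e brings this
   back to s. *)
have [q' q'P] := local_surj psi0 Jpsi N s.
pose q := msubst (fun j => 'X_j - (x j)%:MP) q'.
have Eq : msubst e q = msubst psi q'.
  apply: (mpoly_rmorph_eq
    (phi := msubst e \o msubst (fun j => 'X_j - (x j)%:MP))
    (psi := msubst psi)) => [c|j] /=.
    by rewrite !msubstC.
  by rewrite !msubstX msubstB msubstX msubstC /e addrAC subrr add0r.
rewrite -Eq in q'P.
have hI := max_pow_ideal x N; have hI0 := max_pow_ideal origin N.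
have DEq : max_pow x N (msubst H (msubst e q)).
  rewrite -(subKr (msubst H s) (msubst H _)) -msubstB; apply: (ideal_setB hI DsN).
  exact: local_max_pow.
have qN : max_pow x N q.
  rewrite -(subrK (msubst H (msubst e q)) q); apply: (ideal_setD hI) DEq.
  by apply: max_pow_le (DE q); rewrite /M -addn2 leq_addr.
rewrite -(subrK (msubst e q) s); exact: (ideal_setD hI0 q'P (Emax _ qN)).
Qed.

End LocalCoordinates.

Lemma gen_ideal_takeE (A : comNzRingType) (r : nat) (h : r.-tuple A) k :
  gen_ideal (take k h) =
  [set a | exists c : 'I_r -> A, a = \sum_(j < r | (j < k)%N) c j * tnth h j].
Proof.
apply/seteqP; split=> [|_ [c ->]].
  apply: gen_ideal_sub => [|a a_in].
    split=> [|_ _ [c ->] [d ->]|a _ [c ->]].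
    - by exists (fun=> 0); rewrite big1 // => j _; rewrite mul0r.
    - by exists (fun j => c j + d j); rewrite -big_split; apply: eq_bigr => j _;
        rewrite mulrDl.
    - by exists (fun j => a * c j); rewrite mulr_sumr; apply: eq_bigr => j _;
        rewrite mulrA.
  case/(nthP 0): a_in => i.
  rewrite size_take_min size_tuple leq_min => /andP[ltik ltir] <-.
  exists (fun j => (j == Ordinal ltir)%:R).
  rewrite (bigD1 (Ordinal ltir)) //= eqxx mul1r big1 => [|j /andP[_ /negPf ->]].
    by rewrite addr0 (tnth_nth 0) nth_take.
  by rewrite mul0r.
apply: ideal_set_sum => [|j ltjk]; first exact: gen_ideal_ideal.
apply: (ideal_setM (gen_ideal_ideal _)); apply: gen_ideal_mem.
have ltj : (j < size (take k h))%N by rewrite size_take_min size_tuple leq_min ltjk /=.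
by rewrite (tnth_nth 0) -(nth_take 0 ltjk) mem_nth.
Qed.

(** * Ideals generated by part of a system of local coordinates *)

Section RegularParameters.
Variables (K : fieldType) (n r : nat) (x : 'I_n -> K) (h : r.-tuple {mpoly K[n]}).
Hypothesis hx : forall j, (tnth h j).@[x] = 0.
Hypothesis hJ : row_free (jacobian_mx x (tnth h)).
Notation origin := (fun _ : 'I_n => 0 : K).

Let fullJ : row_full (jacobian_mx x (tnth h))^T.
Proof. by rewrite /row_full mxrank_tr. Qed.

(* The columns of an invertible maximal minor. *)
Definition pivot : 'I_r -> 'I_n := fullrankfun fullJ.

Lemma pivot_inj : injective pivot. Proof. exact: fullrankfun_inj. Qed.

Let coord (i : 'I_n) : {mpoly K[n]} :=
  if [pick j | pivot j == i] is Some j then tnth h j else 'X_i - (x i)%:MP.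

Let coord_pivot j : coord (pivot j) = tnth h j.
Proof.
rewrite /coord; case: pickP => [l /eqP/pivot_inj -> //|/(_ j)].
by rewrite eqxx.
Qed.

Let coord_free i : i \notin codom pivot -> coord i = 'X_i - (x i)%:MP.
Proof.
rewrite /coord; case: pickP => // j /eqP <- /negP[]; exact: codom_f.
Qed.

Let coord_x i : (coord i).@[x] = 0.
Proof.
have [/codomP[j ->]|/coord_free ->] := boolP (i \in codom pivot).
  by rewrite coord_pivot.
by rewrite mevalB mevalXU mevalC subrr.
Qed.

(** The rows outside the pivots are unit vectors and kill those entries of a kernel vector; what is
    left meets the invertible pivot minor. *)
Let coord_jacobian : jacobian_mx x coord \in unitmx.
Proof.
rewrite -unitmx_tr -row_free_unit -kermx_eq0; apply/rowV0P => v /sub_kermxP.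
move=> /rowP vJ.
have v0 i : i \notin codom pivot -> v 0 i = 0.
  move=> fi; have := vJ i; rewrite !mxE (bigD1 i) //= big1 => [|l /negPf li].
    rewrite !mxE coord_free // mderivB mderivXU mderivC subr0 eqxx.
    by rewrite meval1 mulr1 addr0.
  by rewrite !mxE coord_free // mderivB mderivXU mderivC subr0 eq_sym li meval0 mulr0.
pose w := \row_j v 0 (pivot j).
have w0 : w = 0.
  have /row_free_inj inj : row_free (rowsub pivot (jacobian_mx x (tnth h))^T).
    by rewrite row_free_unit fullrowsub_unit.
  apply: inj; rewrite mul0mx; apply/rowP => j; have := vJ (pivot j).
  rewrite !mxE => E; rewrite -[RHS]E (bigID (mem (codom pivot))) /= [X in _ = _ + X]big1.
    rewrite addr0 (reindex_onto pivot (fun i => odflt j [pick j | pivot j == i])) /=.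
      apply: eq_big => [l|l _]; last by rewrite !mxE coord_pivot.
      rewrite codom_f /=; case: pickP => [l' /eqP/pivot_inj ->|/(_ l)]; by rewrite eqxx.
    move=> i /codomP[l ->]; case: pickP => [l' /eqP //|/(_ l)]; by rewrite eqxx.
  by move=> i /v0 ->; rewrite mul0r.
apply/rowP => i; rewrite mxE.
have [/codomP[j ->]|/v0 //] := boolP (i \in codom pivot).
by have := congr1 (fun u : 'rV_r => u 0 j) w0; rewrite !mxE.
Qed.

Notation D := (msubst coord).
Notation J k := (gen_ideal (take k h)).

(* The contraction of (h_1, ..., h_k) O_x to K[X], see [local_primeP]; it is
   defined by m_x-adic approximation so that primality can be read off in
   local coordinates. *)
Definition local_prime k : set {mpoly K[n]} :=
  [set q | forall N, exists2 a, J k a & max_pow x N (q - a)].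

Let J_ideal k : ideal_set (J k). Proof. exact: gen_ideal_ideal. Qed.

Let J_tnth k (j : 'I_r) : (j < k)%N -> J k (tnth h j).
Proof.
rewrite gen_ideal_takeE => ltjk; exists (fun i => (i == j)%:R).
rewrite (bigD1 j) //= eqxx mul1r big1 ?addr0 // => i /andP[_ /negPf ->].
by rewrite mul0r.
Qed.

(** In the coordinates z the polynomials h_1, ..., h_k become variables; setting them to 0 realizes
    the quotient inside K[z]. *)
Let kill k : 'I_n -> {mpoly K[n]} :=
  fun i => if [exists j : 'I_r, (j < k)%N && (pivot j == i)] then 0 else 'X_i.

Let kill_pivot k (j : 'I_r) : kill k (pivot j) = if (j < k)%N then 0 else 'X_(pivot j).
Proof.
rewrite /kill; case: existsP => [[l /andP[ltl /eqP/pivot_inj <-]]|nex]; first by rewrite ltl.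
by case: ifP => // ltj; case: nex; exists j; rewrite ltj eqxx.
Qed.

Let kill_max_pow k N s : max_pow origin N s -> max_pow origin N (msubst (kill k) s).
Proof.
apply: max_pow_rmorph => j.
change ((msubst (kill k) ('X_j - 0%:MP)).@[origin] = 0).
rewrite mpolyC0 subr0 msubstX /kill; case: ifP => _; first by rewrite meval0.
by rewrite mevalXU.
Qed.

Let kill_congr k s : J k (D s - D (msubst (kill k) s)).
Proof.
apply: (mpoly_rmorph_congr (phi := D) (psi := D \o msubst (kill k)) (J_ideal k)).
  move=> c; change (J k (D c%:MP - D (msubst (kill k) c%:MP))).
  by rewrite !msubstC subrr; apply: (ideal_set0 (J_ideal k)).
move=> i; change (J k (D 'X_i - D (msubst (kill k) 'X_i))).
rewrite !msubstX /kill; case: ifP => [/existsP[j /andP[ltj /eqP <-]]|_].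
  by rewrite [D 0]rmorph0 subr0 coord_pivot; apply: J_tnth.
by rewrite msubstX subrr; apply: (ideal_set0 (J_ideal k)).
Qed.

(** A combination t of the killed variables with D t close to a is subtracted from s; injectivity of
    the coordinate change bounds the order of s - t from below, and killing removes t. *)
Let kill_local k N s a :
  J k a -> max_pow x N (D s - a) -> max_pow origin N (msubst (kill k) s).
Proof.
rewrite gen_ideal_takeE => -[c aE] sN.
have [d dN] := choice (fun j => local_surj coord_x coord_jacobian N (c j)).
pose t := \sum_(j < r | (j < k)%N) d j * 'X_(pivot j).
have t0 : msubst (kill k) t = 0.
  rewrite msubst_sum big1 // => j ltj.
  by rewrite msubstM msubstX kill_pivot ltj mulr0.
have tN : max_pow x N (a - D t).
  rewrite aE msubst_sum -sumrB; apply: (ideal_set_sum _ (max_pow_ideal x N)) => j ltj.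
  rewrite msubstM msubstX coord_pivot -mulrBl.
  exact: (ideal_setMr _ (max_pow_ideal x N) (dN j)).
have stN : max_pow x N (D (s - t)).
  rewrite msubstB -(subrKA a); exact: (ideal_setD (max_pow_ideal x N) sN tN).
have := kill_max_pow k (local_inj coord_x coord_jacobian stN).
by rewrite msubstB t0 subr0.
Qed.

Lemma gen_ideal_local_prime k : J k `<=` local_prime k.
Proof.
move=> a Ja N; exists a => //; rewrite subrr; exact: (ideal_set0 (max_pow_ideal _ _)).
Qed.

Lemma local_prime_ideal k : ideal_set (local_prime k).
Proof.
split=> [N|p q Pp Pq N|p q Pq N].
- exists 0; first exact: (ideal_set0 (J_ideal k)).
  by rewrite subrr; exact: (ideal_set0 (max_pow_ideal x N)).
- have [[a Ja pa] [b Jb qb]] := (Pp N, Pq N).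
  exists (a + b); first exact: (ideal_setD (J_ideal k) Ja Jb).
  by rewrite opprD addrACA; exact: (ideal_setD (max_pow_ideal x N) pa qb).
- have [b Jb qb] := Pq N; exists (p * b); first exact: (ideal_setM (J_ideal k) _ Jb).
  by rewrite -mulrBr; exact: (ideal_setM (max_pow_ideal x N) _ qb).
Qed.

Lemma local_prime_meval k q : local_prime k q -> q.@[x] = 0.
Proof.
move=> /(_ 1%N)[a]; rewrite gen_ideal_takeE => -[c ->] /max_pow1P.
rewrite mevalB (raddf_sum (meval x)) big1 ?subr0 // => j _.
by rewrite /= mevalM hx mulr0.
Qed.

(** If p and q fail to be approximated at orders M and N, both are represented to order M + N in the
    coordinates z. After killing, the product has order at least M + N, so one factor has an order
    that permits its approximation. *)
Lemma local_prime_prime k : prime_set (local_prime k).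
Proof.
have hI N := max_pow_ideal x N.
split=> [||p q Ppq]; first exact: local_prime_ideal.
  by move=> /local_prime_meval/eqP; rewrite meval1 oner_eq0.
have approx q' s M N : (N <= M)%N -> max_pow x M (q' - D s) ->
    max_pow origin N (msubst (kill k) s) ->
    exists2 a, J k a & max_pow x N (q' - a).
  move=> leNM qs sN; exists (D s - D (msubst (kill k) s)); first exact: kill_congr.
  rewrite opprB addrA [q' + _]addrC -addrA.
  apply: (ideal_setD (hI N)) (max_pow_le leNM qs).
  exact: local_max_pow coord_x _ _ sN.
apply: contrapT => /not_orP[nPp nPq].
have [M nM] : exists M, ~ exists2 a, J k a & max_pow x M (p - a).
  by apply: contrapT => nex; apply: nPp => M; apply: contrapT => nM; apply: nex; exists M.
have [N nN] : exists N, ~ exists2 a, J k a & max_pow x N (q - a).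
  by apply: contrapT => nex; apply: nPq => N; apply: contrapT => nN; apply: nex; exists N.
have [s sP] := local_surj coord_x coord_jacobian (M + N) p.
have [t tP] := local_surj coord_x coord_jacobian (M + N) q.
have [a Ja aP] := Ppq (M + N)%N.
have : max_pow origin (M + N) (msubst (kill k) (s * t)).
  apply: (kill_local Ja); rewrite msubstM -(subrKA (p * q)).
  apply: (ideal_setD (hI _)) aP; rewrite -opprB mulrBB.
  apply: (ideal_setN (hI _)); apply: (ideal_setD (hI _)).
    exact: (ideal_setMr _ (hI _) sP).
  exact: (ideal_setM (hI _) _ tP).
rewrite msubstM => /max_pow_origin_prime[sM|tN].
  by apply: nM; apply: approx sP sM; rewrite leq_addr.
by apply: nN; apply: approx tP tN; rewrite leq_addl.
Qed.

(** The variable of this element survives the killing of the first k ones and has order 1. *)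
Lemma local_prime_next (k : 'I_r) : ~ local_prime k (tnth h k).
Proof.
move=> /(_ 2%N)[a Ja]; rewrite -coord_pivot -(msubstX coord) => /(kill_local Ja).
rewrite msubstX kill_pivot ltnn => /max_pow2P[_ /(_ (pivot k))].
by rewrite mderivXU eqxx meval1 => /eqP; rewrite oner_eq0.
Qed.

Lemma local_primeP k q :
  local_prime k q <-> exists2 b : {mpoly K[n]}, b.@[x] != 0 & J k (b * q).
Proof.
split=> [|[b bx /gen_ideal_local_prime/(prime_mul (local_prime_prime k))[|//]]].
  exact: krull_intersection.
by move=> /local_prime_meval/eqP; rewrite (negPf bx).
Qed.

Lemma local_prime_gradient q : local_prime r q ->
  exists l : 'I_r -> K, forall i,
    q^`M(i).@[x] = \sum_j l j * (tnth h j)^`M(i).@[x].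
Proof.
move=> /(_ 2%N)[a]; rewrite gen_ideal_takeE => -[c ->] /max_pow2P[_ dq].
exists (fun j => (c j).@[x]) => i; apply/eqP; rewrite -subr_eq0; apply/eqP.
rewrite -[RHS](dq i) mderivB mevalB; congr (_ - _).
rewrite (raddf_sum (mderiv i)) (raddf_sum (meval x)) [RHS](eq_bigl xpredT) => [|j]; last first.
  by rewrite ltn_ord.
by apply: eq_bigr => j _; rewrite /= mderivM mevalD !mevalM hx mulr0 add0r.
Qed.

(** The n - r coordinates outside the pivots are independent modulo the prime: recentred at x, such
    a q is unchanged by killing, so it vanishes to every order at the origin. *)
Lemma local_prime_free q :
  msubst (fun i => if i \in codom pivot then 0 else 'X_i) q = q ->
  local_prime r q -> q = 0.
Proof.
set kap := fun i => _; move=> qE Pq.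
pose s := msubst (fun i => 'X_i + (x i)%:MP) q.
have sE : D s = q.
  rewrite /s -[in LHS]qE -[RHS]qE.
  apply: (mpoly_rmorph_eq (phi := D \o (msubst (fun i => 'X_i + (x i)%:MP) \o msubst kap))
     (psi := msubst kap)) => [c|i] /=; first by rewrite !msubstC.
  rewrite msubstX /kap; case: ifPn => [_|fi]; first by rewrite !rmorph0.
  by rewrite msubstX msubstD msubstX msubstC coord_free // subrK.
have ks : msubst (kill r) s = s.
  rewrite /s -qE.
  apply: (mpoly_rmorph_eq (phi := msubst (kill r) \o (msubst (fun i => 'X_i + (x i)%:MP) \o msubst kap))
     (psi := msubst (fun i => 'X_i + (x i)%:MP) \o msubst kap)) => [c|i] /=.
    by rewrite !msubstC.
  rewrite msubstX /kap; case: ifPn => [_|fi]; first by rewrite !rmorph0.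
  rewrite !msubstX msubstD msubstX msubstC /kill; case: existsP => // -[j /andP[_ /eqP E]].
  by case/negP: fi; rewrite -E codom_f.
have s0 : s = 0.
  apply: max_pow_origin_inter => N; rewrite -ks; have [a Ja aP] := Pq N.
  by apply: (kill_local Ja); rewrite sE.
by rewrite -sE s0 rmorph0.
Qed.

End RegularParameters.

(** * Algebraically independent coordinates modulo a prime *)

Lemma ideal_quotient (A : comNzRingType) (Q : set A) : ideal_set Q -> ~ Q 1 ->
  exists (B : comNzRingType) (pi : {rmorphism A -> B}),
    forall u, pi u = 0 <-> Q u.
Proof.
move=> hQ Q1; pose I := fun q : A => `[< Q q >].
have I_ideal : idealr_closed I.
  split=> [||a u v /asboolP Iu /asboolP Iv]; first by apply/asboolP; apply: ideal_set0.
    by apply/negP => /asboolP.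
  by apply/asboolP; apply: ideal_setD => //; apply: ideal_setM.
pose IaM := GRing.isZmodClosed.Build _ I (idealr_closedB I_ideal).
pose IpM := isProperIdeal.Build _ I (idealr_closed_nontrivial I_ideal).
pose Iid : idealr _ := HB.pack I IaM IpM.
exists {ideal_quot Iid}, \pi_{ideal_quot Iid}%qT => u.
have E : (\pi_{ideal_quot Iid}%qT u == 0) = I u by rewrite piE Quotient.equivE subr0.
by split=> [/eqP|Qu]; [rewrite E => /asboolP|apply/eqP; rewrite E; apply/asboolP].
Qed.

Section Dimension.
Variables (K : fieldType) (n : nat).
Implicit Types (S : {set 'I_n}) (Q : set {mpoly K[n]}).

Definition keep S : 'I_n -> {mpoly K[n]} := fun i => if i \in S then 'X_i else 0.

(* The polynomials in the coordinates of S are the fixed points of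
   [msubst (keep S)]. *)
Definition independent_mod S Q :=
  forall q, msubst (keep S) q = q -> Q q -> q = 0.

Lemma keep_idem S q : msubst (keep S) (msubst (keep S) q) = msubst (keep S) q.
Proof.
apply: (mpoly_rmorph_eq (phi := msubst (keep S) \o msubst (keep S))
  (psi := msubst (keep S))) => [c|i] /=; first by rewrite !msubstC.
rewrite msubstX /keep; case: ifP => [iS|_]; last by rewrite rmorph0.
by rewrite msubstX /keep iS.
Qed.

(** With l the leading coefficient and d the degree, multiplying the equation of b by l^(d-1) makes
    it monic in l b. *)
Lemma integral_mul_lead (A B : comNzRingType) (f : {rmorphism A -> B})
    (p : {poly A}) (b : B) : (1 < size p)%N ->
  (map_poly f p).[b] = 0 -> integralOver f (f (lead_coef p) * b).
Proof.
move=> lt1p pb0; set l := lead_coef p; pose d := (size p).-1.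
have szp : size p = d.+1 by rewrite prednK // ltnW.
have d_gt0 : (0 < d)%N by rewrite -ltnS -szp.
pose g := \poly_(i < d.+1) (if (i < d)%N then p`_i * l ^+ (d.-1 - i) else 1).
have gd : g`_d = 1 by rewrite coef_poly ltnSn ltnn.
have szg : size g = d.+1 by rewrite size_poly_eq // ltnn oner_eq0.
exists g; first by rewrite monicE lead_coefE szg gd.
have sz_le : (size (map_poly f g) <= d.+1)%N by rewrite -szg size_poly.
have sz_leP : (size (map_poly f p) <= d.+1)%N by rewrite -szp size_poly.
rewrite rootE (horner_coef_wide _ sz_le).
apply/eqP; transitivity (f l ^+ d.-1 * (map_poly f p).[b]); last by rewrite pb0 mulr0.
rewrite (horner_coef_wide _ sz_leP) mulr_sumr; apply: eq_bigr => i _.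
rewrite !coef_map exprMn coef_poly ltn_ord; case: ltnP => [ltid|leid].
  have leid : (i <= d.-1)%N by rewrite -ltnS (prednK d_gt0).
  rewrite /= rmorphM rmorphXn /= !mulrA; congr (_ * _).
  by rewrite -mulrA -exprD (subnK leid) [LHS]mulrC.
have -> : i = d :> nat by apply/eqP; rewrite eqn_leq leid -ltnS ltn_ord.
rewrite /= rmorph1 mul1r mulrA; congr (_ * _).
by rewrite -[p`_d]/(p`_(size p).-1) -lead_coefE -exprSr prednK.
Qed.

(* Otherwise every coordinate is algebraic over K[X_S] modulo Q, hence so is q,
   and the constant term of an equation of q lies in Q'. *)
Lemma independent_mod_step S Q Q' q : prime_set Q -> ideal_set Q' ->
  Q `<=` Q' -> Q' q -> ~ Q q -> independent_mod S Q' ->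
  exists2 j, j \notin S & independent_mod (j |: S) Q.
Proof.
move=> hQ hQ' QQ' Q'q nQq indS; apply: contrapT => nex.
have hI := prime_ideal hQ.
have [B [pi pi0]] := ideal_quotient hI (prime_proper hQ).
have [f fE] : exists f : {rmorphism {mpoly K[n]} -> B},
    forall u, f u = pi (msubst (keep S) u) by exists (pi \o msubst (keep S)).
have fK u : msubst (keep S) u = u -> f u = pi u by rewrite fE => ->.
have indQ u : msubst (keep S) u = u -> Q u -> u = 0 by move=> uE /QQ'; apply: indS.
(* For j outside S the failure of independence gives a relation of X_j over K[X_S] modulo Q. It has
   positive degree in X_j because S is independent modulo Q, and its leading coefficient is the
   denominator. *)
have den j : exists l, [/\ msubst (keep S) l = l, l != 0 & integralOver f (pi (l * 'X_j))].
  have [jS|jS] := boolP (j \in S).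
    exists 1; split; rewrite ?rmorph1 ?oner_eq0 // mul1r -fK; first exact: integral_id.
    by rewrite msubstX /keep jS.
  have [p [pE Qp p0]] : exists p, [/\ msubst (keep (j |: S)) p = p, Q p & p != 0].
    apply: contrapT => nexp; apply: nex; exists j => // p pE Qp; apply/eqP.
    by apply: contrapT => /negP p0; apply: nexp; exists p.
  pose tau : {rmorphism {mpoly K[n]} -> {poly {mpoly K[n]}}} :=
    mmap (polyC \o @mpolyC n K) (fun i => if i == j then 'X else (keep S i)%:P).
  pose g := tau p.
  have gX : g.['X_j] = p.
    rewrite -[RHS]pE; apply: (mpoly_rmorph_eq (phi := horner_eval 'X_j \o tau)
      (psi := msubst (keep (j |: S)))) => [c|i] /=.
      by rewrite mmapC msubstC horner_evalE hornerC.
    rewrite mmapXU msubstX horner_evalE /keep !inE.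
    by case: eqP => [->|_]; rewrite ?hornerX ?hornerC.
  have gK : map_poly (msubst (keep S)) g = g.
    apply: (mpoly_rmorph_eq (phi := map_poly (msubst (keep S)) \o tau)
      (psi := tau)) => [c|i] /=; first by rewrite !mmapC /= map_polyC /= msubstC.
    rewrite !mmapXU; case: eqP => [_|_]; first by rewrite map_polyX.
    rewrite map_polyC /= /keep; case: ifP => iS; last by rewrite rmorph0.
    by rewrite msubstX /keep iS.
  have gKi i : msubst (keep S) g`_i = g`_i by rewrite -{2}gK coef_map.
  have g0 : g != 0 by apply: contraNneq p0 => g0; rewrite -gX g0 horner0.
  exists (lead_coef g); split; rewrite ?lead_coef_eq0 // ?lead_coefE ?gKi //.
  rewrite -lead_coefE rmorphM -fK; last by rewrite lead_coefE gKi.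
  apply: integral_mul_lead.
    rewrite ltnNge; apply: contraNN p0 => /size1_polyC gE; rewrite -gX gE hornerC.
    by apply/eqP; apply: indQ; rewrite ?gKi // -[g`_0](hornerC _ 'X_j) -gE gX.
  have -> : map_poly f g = map_poly pi g.
    by rewrite -{2}gK -map_poly_comp; apply: eq_map_poly => v; rewrite fE.
  by rewrite horner_map gX; apply/pi0.
(* One L serves all coordinates: for every u some L^k u is integral over K[X_S] modulo Q. *)
have [l lP] := choice den; pose L := \prod_j l j.
have LK : msubst (keep S) L = L.
  by rewrite [LHS]rmorph_prod; apply: eq_bigr => j _; case: (lP j).
have L0 : L != 0 by apply/prodf_neq0 => j _; case: (lP j).
have intL k : integralOver f (pi (L ^+ k)).
  by rewrite -fK ?[LHS]rmorphXn /= ?LK //; apply: integral_id.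
have intLX u : exists k, integralOver f (pi (L ^+ k * u)).
  elim/mpoly_ring_ind: u => [c|i|u v [a ua] [b vb]|u v [a ua] [b vb]].
  - exists 0%N; rewrite expr0 mul1r -fK ?msubstC //; exact: integral_id.
  - exists 1%N; rewrite expr1 /L (bigD1 i) //= mulrAC rmorphM mulrC.
    have [_ _ int_i] := lP i; rewrite mulrC; apply: integral_mul int_i _.
    rewrite -fK; first exact: integral_id.
    by rewrite [LHS]rmorph_prod; apply: eq_bigr => j _; case: (lP j).
  - exists (a + b)%N; rewrite mulrDr rmorphD; apply: integral_add.
      by rewrite exprD mulrAC rmorphM; apply: integral_mul.
    by rewrite addnC exprD mulrAC rmorphM; apply: integral_mul.
  - by exists (a + b)%N; rewrite exprD mulrACA rmorphM; apply: integral_mul.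
have [k [p mon_p /rootP pu]] := intLX q; set u := L ^+ k * q in pu.
have nQu : ~ Q u.
  case/(prime_mul hQ) => // /(prime_exp hQ) QL; case/eqP: L0; exact: indQ.
have Q'u : Q' u by apply: ideal_setM.
(* As u lies in Q', so does the constant term of g, which is then 0 by independence; as u lies
   outside the prime Q, it can be cancelled. Applied to a monic equation of u this is absurd. *)
have key (g : {poly {mpoly K[n]}}) :
    (forall i, msubst (keep S) g`_i = g`_i) -> Q g.[u] -> g = 0.
  elim/poly_ind: g => [//|g c IHg] gK; rewrite hornerMXaddC => Qg.
  have c0 : c = 0.
    apply: indS; first by have := gK 0%N; rewrite coefD coefMX coefC /= add0r.
    rewrite -[c](addKr (g.[u] * u)) addrC; apply: ideal_setB => //.
      exact: QQ'.
    exact: ideal_setM.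
  move: Qg gK; rewrite c0 addr0 => Qg gK; rewrite IHg ?mul0r ?addr0 ?polyC0 //.
    by move=> i; have := gK i.+1; rewrite polyC0 addr0 coefMX.
  by case/(prime_mul hQ): Qg.
have : map_poly (msubst (keep S)) p = 0.
  apply: key => [i|]; first by rewrite coef_map /= keep_idem.
  apply/pi0; rewrite -horner_map -[RHS]pu -map_poly_comp /=.
  by congr horner; apply: eq_map_poly => v; rewrite fE.
move/(congr1 (fun g : {poly {mpoly K[n]}} => g`_(size p).-1)).
rewrite coef_map /= -lead_coefE (monicP mon_p) rmorph1 coef0 => /eqP.
by rewrite oner_eq0.
Qed.

(** Each strict inclusion enlarges an independent set of coordinates by one, and there are only n
    coordinates. *)
Lemma prime_chain_bound (Q : nat -> set {mpoly K[n]}) d S :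
  (forall k, (k <= d)%N -> prime_set (Q k)) ->
  (forall k, (k < d)%N -> Q k.+1 `<` Q k) ->
  independent_mod S (Q 0%N) -> (#|S| + d <= n)%N.
Proof.
move=> primeQ ltQ ind0.
suff [T cardT _] : exists2 T : {set 'I_n}, #|T| = (#|S| + d)%N & independent_mod T (Q d).
  by rewrite -cardT -[X in (_ <= X)%N]card_ord max_card.
elim: d primeQ ltQ => [|d IHd] primeQ ltQ; first by exists S; rewrite ?addn0.
have [|k ltkd|T cardT indT] := IHd; first by move=> k lekd; apply: primeQ; apply: leqW.
  by apply: ltQ; apply: leqW.
have [subQ nsubQ] := ltQ d (ltnSn d).
have [q [Qq nQq]] : exists q, Q d q /\ ~ Q d.+1 q.
  apply: contrapT => nexq; apply: nsubQ => q Qq; apply: contrapT => nQq.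
  by apply: nexq; exists q.
have [||j jT indjT] := independent_mod_step _ _ subQ Qq nQq indT.
- exact: primeQ.
- by apply: prime_ideal; apply: primeQ.
by exists (j |: T); rewrite ?cardsU1 ?jT ?cardT ?addnS.
Qed.

End Dimension.

(** * Smooth complete intersections *)

Section LocalRingIdeals.
Variables (K : fieldType) (n : nat) (x : 'rV[K]_n).
Implicit Types (s : seq {mpoly K[n]}) (u : local_ring x) (p q b : {mpoly K[n]}).

Lemma germM p q : germ x (p * q) = germ x p * germ x q.
Proof. by apply: val_inj; rewrite rmorphM /= tofracM. Qed.

Lemma germ_sum (I : Type) (r : seq I) (F : I -> {mpoly K[n]}) :
  germ x (\sum_(i <- r) F i) = \sum_(i <- r) germ x (F i).
Proof. by apply: val_inj; rewrite rmorph_sum /= rmorph_sum. Qed.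

Lemma tofrac_meval_neq0 b : b.@[x 0] != 0 -> tofrac b != 0.
Proof. by rewrite tofrac_eq0; apply: contraNneq => ->; rewrite meval0. Qed.

Lemma local_ring_frac u : exists p b,
  [/\ b.@[x 0] != 0 & \val u * tofrac b = tofrac p].
Proof.
case: u => u /= /asboolP[p [b [b0 ->]]]; exists p, b; split=> //.
by rewrite divfK ?tofrac_meval_neq0.
Qed.

Lemma germ_unit b : b.@[x 0] != 0 -> exists u, u * germ x b = 1.
Proof.
move=> b0; have ub : (tofrac b)^-1 \in regular_at x.
  by apply/asboolP; exists 1, b; rewrite tofrac1 mul1r.
exists (LocalRing ub); apply: val_inj.
by rewrite rmorphM rmorph1 /= mulVf ?tofrac_meval_neq0.
Qed.

Lemma gen_ideal_germP s u :
  gen_ideal [seq germ x q | q <- s] u <->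
  exists p b, [/\ b.@[x 0] != 0, gen_ideal s p & \val u * tofrac b = tofrac p].
Proof.
have hs := gen_ideal_ideal s.
split=> [|[p [b [b0 sp E]]]].
  pose I := [set u | exists p b, [/\ b.@[x 0] != 0, gen_ideal s p &
    \val (u : local_ring x) * tofrac b = tofrac p]].
  apply: (@gen_ideal_sub _ _ I) => [|_ /mapP[q sq ->]].
    split=> [|v w [p [b [b0 sp E]]] [p' [b' [b'0 sp' E']]]|v w [p [b [b0 sp E]]]].
    - exists 0, 1; rewrite meval1 oner_eq0 rmorph0 mul0r tofrac0; split=> //.
      exact: ideal_set0.
    - exists (p * b' + p' * b), (b * b'); rewrite mevalM mulf_neq0 //; split=> //.
        by apply: (ideal_setD hs); apply: ideal_setMr.
      by rewrite rmorphD mulrDl !(tofracD, tofracM) -E -E' mulrA [tofrac b * _]mulrC mulrA.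
    - have [p' [b' [b'0 E']]] := local_ring_frac v.
      exists (p' * p), (b' * b); rewrite mevalM mulf_neq0 //; split=> //.
        exact: ideal_setM.
      by rewrite rmorphM !tofracM -E -E' mulrACA.
  exists q, 1; rewrite meval1 oner_eq0 tofrac1 mulr1; split=> //.
  exact: gen_ideal_mem.
have [v vb] := germ_unit b0.
have -> : u = v * germ x p.
  rewrite -[LHS]mul1r -vb -mulrA; congr (_ * _); apply: val_inj.
  by rewrite rmorphM /= mulrC.
apply: (ideal_setM (gen_ideal_ideal _)); case: sp => c ->; rewrite germ_sum.
apply: (ideal_set_sum _ (gen_ideal_ideal _)) => i _; rewrite germM.
apply: (ideal_setM (gen_ideal_ideal _)); apply: gen_ideal_mem.
by apply: map_f; apply: mem_nth.
Qed.

End LocalRingIdeals.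

Section ZariskiFacts.
Variables (K : fieldType) (n : nat).
Implicit Types (S P : set {mpoly K[n]}) (X Y Z : set 'rV[K]_n).

Lemma zeros_zclosed S : zclosed (zeros S). Proof. by exists S. Qed.

Lemma zclosedU Y Z : zclosed Y -> zclosed Z -> zclosed (Y `|` Z).
Proof.
move=> [S ->] [T ->]; exists [set q | exists a b, [/\ S a, T b & q = a * b]].
apply/seteqP; split=> [x [xS|xT] _ [a [b [Sa Tb ->]]]|x xST].
- by rewrite mevalM (xS a Sa) mul0r.
- by rewrite mevalM (xT b Tb) mulr0.
have [?|nxS] := pselect (zeros S x); [by left|right=> b Tb].
have [a Sa xa] : exists2 a, S a & a.@[x 0] != 0.
  apply: contrapT => nex; apply: nxS => a Sa; apply/eqP; apply: contrapT => /negP ax.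
  by apply: nex; exists a.
have /eqP : (a * b).@[x 0] = 0 by apply: xST; exists a, b.
by rewrite mevalM mulf_eq0 (negPf xa) => /eqP.
Qed.

Lemma zclosedI Y Z : zclosed Y -> zclosed Z -> zclosed (Y `&` Z).
Proof.
move=> [S ->] [T ->]; exists (S `|` T); apply/seteqP; split=> [x [xS xT] q [/xS|/xT]//|x xST].
by split=> q ?; apply: xST; [left|right].
Qed.

Lemma zclosed_sep Z x : zclosed Z -> ~ Z x ->
  exists q, q.@[x 0] != 0 /\ forall y, Z y -> q.@[y 0] = 0.
Proof.
move=> [S ->] nx; apply: contrapT => nex; apply: nx => q Sq; apply/eqP.
by apply: contrapT => /negP qx; apply: nex; exists q; split=> // y; apply.
Qed.

Lemma vanishing_prime X : zirreducible X -> prime_set (vanishing X).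
Proof.
move=> [[x Xx] irrX]; split=> [||a b Xab].
- split=> [y _|a b Xa Xb y Xy|a b Xb y Xy]; first exact: meval0.
    by rewrite mevalD (Xa y Xy) (Xb y Xy) addr0.
  by rewrite mevalM (Xb y Xy) mulr0.
- by move=> /(_ x Xx)/eqP; rewrite meval1 oner_eq0.
have [|Xa|Xb] := irrX _ _ (zeros_zclosed [set a]) (zeros_zclosed [set b]).
- move=> y /Xab/eqP; rewrite mevalM mulf_eq0 => /orP[]/eqP y0; [left|right];
  by move=> q ->.
- by left=> y /Xa; apply.
- by right=> y /Xb; apply.
Qed.

Lemma zeros_vanishing X : zclosed X -> zeros (vanishing X) = X.
Proof.
move=> [S ->]; apply/seteqP; split=> [x xX q Sq|x Xx q]; last by apply.
by apply: xX => y; apply.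
Qed.

End ZariskiFacts.

Section Nullstellensatz.
Variables (K : closedFieldType) (n : nat).
Implicit Types (P : set {mpoly K[n]}).

Lemma vanishing_zeros P : prime_set P -> vanishing (zeros P) = P.
Proof.
move=> hP; apply/seteqP; split=> [q qP|q Pq x]; last by apply.
apply: contrapT => nPq.
have [c|a [aP aq]] := nullstellensatz (iota := idfun) hP _ nPq.
  split=> [Pc|/= ->]; last by rewrite mpolyC0; apply: ideal_set0 (prime_ideal hP).
  apply/eqP; apply: contrapT => /negP c0; apply: (prime_proper hP).
  have -> : 1 = c^-1%:MP * c%:MP :> {mpoly K[n]} by rewrite -mpolyCM mulVf.
  exact: (ideal_setM (prime_ideal hP) _ Pc).
case/eqP: aq; have E p : mmap idfun a p = p.@[(\row_j a j) 0].
  by apply: meval_eq => j; rewrite mxE.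
by rewrite E; apply: qP => p Pp; rewrite -E (aP p Pp).
Qed.

Lemma zeros_irreducible P : prime_set P -> zirreducible (zeros P).
Proof.
move=> hP; have EP := vanishing_zeros hP; split.
  apply: contrapT => /nonemptyPn zP0; apply: (prime_proper hP).
  by rewrite -EP zP0 => x.
move=> Y Z [S ->] [T ->] VYZ; apply: contrapT => /not_orP[nY nZ].
have sep U : ~ zeros P `<=` zeros U -> exists2 q, U q & ~ P q.
  move=> nU; apply: contrapT => nex; apply: nU => x Px q Uq.
  by apply: Px; apply: contrapT => nPq; apply: nex; exists q.
have [[a Sa nPa] [b Tb nPb]] := (sep _ nY, sep _ nZ).
have : P (a * b).
  rewrite -EP => x /VYZ[/(_ a Sa)|/(_ b Tb)]; rewrite mevalM => ->.
    by rewrite mul0r.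
  by rewrite mulr0.
by case/(prime_mul hP).
Qed.

End Nullstellensatz.

Section SmoothCompleteIntersection.
Variables (K : closedFieldType) (n r : nat) (h : r.-tuple {mpoly K[n]}).
Variable (Z : set 'rV[K]_n).
Hypothesis closedZ : zclosed Z.
Let L := zeros [set` h] `\` Z.
Hypothesis freeJ : forall x, L x -> row_free (jacobian_mx (x 0) (tnth h)).

Let h0 x : L x -> forall j, (tnth h j).@[x 0] = 0.
Proof. by move=> [xh _] j; apply: xh; rewrite /= mem_tnth. Qed.

(** In the local ring each initial segment of h generates a prime ideal that does not contain the
    next element, which is therefore no zero divisor modulo it. *)
Lemma regular_seq_complete_intersection : regular_seq_outside Z h.
Proof.
move=> x Lx; have hx := h0 Lx; have J := freeJ Lx; split=> [k|]; last first.
  move=> /gen_ideal_germP[p [b [bx hp]]].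
  rewrite rmorph1 mul1r => /eqP; rewrite tofrac_eq => /eqP E.
  have hp' : gen_ideal (take r h) p by rewrite take_oversize ?size_tuple.
  have := local_prime_meval hx (gen_ideal_local_prime (x 0) hp').
  by rewrite -E; apply/eqP.
rewrite size_map size_tuple => ltkr u; rewrite -map_take (nth_map 0) ?size_tuple //.
rewrite -[h`_k]/(h`_(Ordinal ltkr)) -tnth_nth.
move=> /gen_ideal_germP[p [b [bx hp E]]].
have [q [c [cx Eu]]] := local_ring_frac u.
have : local_prime (x 0) h k (tnth h (Ordinal ltkr) * (b * q)).
  apply: gen_ideal_local_prime.
  have -> : tnth h (Ordinal ltkr) * (b * q) = c * p.
    apply/eqP; rewrite -tofrac_eq !tofracM -E -Eu rmorphM /=; apply/eqP; ring.
  exact: (ideal_setM (gen_ideal_ideal _)).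
case/(prime_mul (local_prime_prime hx J k)) => [/(local_prime_next hx J (k := Ordinal ltkr))//|].
case/(local_primeP hx J) => d dx Jd; apply/gen_ideal_germP.
exists (d * (b * q)), (d * b * c); split=> //; first by rewrite !mevalM !mulf_neq0.
by rewrite !tofracM -Eu; ring.
Qed.

Section AtPoint.
Variable x : 'rV[K]_n.
Hypothesis Lx : L x.
Let hx : forall j, (tnth h j).@[x 0] = 0. Proof. exact: h0. Qed.
Let J : row_free (jacobian_mx (x 0) (tnth h)). Proof. exact: freeJ. Qed.
Let P k := local_prime (x 0) h k.
Let primeP k : prime_set (P k). Proof. exact: local_prime_prime. Qed.

Let zeros_sub : zeros (P r) `<=` zeros [set` h].
Proof.
move=> y yP q hq; apply: yP; apply: gen_ideal_local_prime.
by rewrite take_oversize ?size_tuple //; apply: gen_ideal_mem.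
Qed.

(** Removing Z adds no equations: a polynomial that vanishes on Z but not at x lies outside the
    prime P_r and can be cancelled. *)
Lemma vanishing_local : vanishing (zeros (P r) `\` Z) = P r.
Proof.
apply/seteqP; split=> [q qV|q Pq y [yP _]]; last exact: yP.
have [z [zx zZ]] := zclosed_sep closedZ Lx.2.
have : P r (z * q).
  rewrite -(vanishing_zeros (primeP r)) => y yP; rewrite mevalM.
  have [/zZ ->|nZy] := pselect (Z y); first by rewrite mul0r.
  by rewrite qV ?mulr0.
by case/(prime_mul (primeP r)) => // /(local_prime_meval hx)/eqP; rewrite (negPf zx).
Qed.

(** Each q in P_r has a multiple b q in (h) with b(x) nonzero; as X is irreducible and contains x, q
    vanishes on X. Maximality of X then identifies it with the zeros of P_r off Z. *)
Lemma local_component X : zcomponent L X -> X x -> zclosure X = zeros (P r).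
Proof.
move=> [XL irrX maxX] Xx.
have XV : X `<=` zeros (P r).
  move=> y Xy q /(local_primeP hx J)[b bx]; rewrite take_oversize ?size_tuple // => hbq.
  have [|Xb|Xq] := irrX.2 _ _ (zeros_zclosed [set b]) (zeros_zclosed [set q]).
  - move=> z /XL[zh _]; have : (b * q).@[z 0] = 0.
      by apply: (rmorph_gen_ideal (phi := meval (z 0))) hbq => c hc; apply: zh.
    by rewrite mevalM => /eqP; rewrite mulf_eq0 => /orP[]/eqP z0; [left|right] => _ ->.
  - by move: bx; rewrite (Xb x Xx b) ?eqxx.
  - exact: Xq.
have Vx : zeros (P r) x by move=> q /(local_prime_meval hx).
have irrV := zeros_irreducible (primeP r).
rewrite -(maxX (zeros (P r) `\` Z)).
- by rewrite /zclosure vanishing_local.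
- split=> [|Y1 Y2 cY1 cY2 sub]; first by exists x; split=> //; case: Lx.
  have cYZ := zclosedU cY2 closedZ.
  have [y Vy|VY1|VY] := irrV.2 _ _ cY1 cYZ.
  + have [?|nZ] := pselect (Z y); first by right; right.
    by case: (sub y) => // ?; [left|right; left].
  + by left=> y [/VY1].
  + right; have [//|V2|VZ] := irrV.2 _ _ cY2 closedZ; first by move=> y [/V2].
    by case: Lx => _ []; apply: VZ.
- by move=> y [/zeros_sub].
- by move=> y Xy; split; [apply: XV|case: (XL y Xy)].
Qed.

(** The primes P_k give a chain of length r. A longer one would enlarge the set of the n - r
    independent coordinates outside the pivots beyond n elements. *)
Lemma local_codim : has_codim (zeros (P r)) r.
Proof.
have le_Pk k : P k `<=` P k.+1.
  move=> q /(local_primeP hx J)[b bx hb]; apply/(local_primeP hx J); exists b => //.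
  apply: (gen_ideal_sub (gen_ideal_ideal _)) hb => a ak.
  by apply: gen_ideal_mem; rewrite -[take k h](@take_takel _ k k.+1) // in ak; apply: mem_take ak.
split.
  (* Codimension is measured by chains that ascend from the variety, so the primes are taken in
     descending order. *)
  exists (fun k => zeros (P (r - k))); split=> [|k _|k ltkr].
  - by rewrite subn0.
  - by split; [apply: zeros_zclosed|apply: zeros_irreducible].
  rewrite -(subnSK ltkr); have ltr : (r - k.+1 < r)%N by rewrite ltn_subrL (leq_trans _ ltkr).
  set i := (r - k.+1)%N in ltr *; split=> [y yP q Pq|sub]; first by apply: yP; apply: le_Pk.
  apply: (local_prime_next hx J (k := Ordinal ltr)).
  rewrite -/(P _) -(vanishing_zeros (primeP _)) => y /sub yP; apply: yP.
  apply: gen_ideal_local_prime; apply: gen_ideal_mem.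
  rewrite (tnth_nth 0) -(nth_take 0 (ltnSn i)) mem_nth //.
  by rewrite size_take_min size_tuple leq_min ltnSn.
move=> d [T [T0 irrT ltT]].
pose S := ~: [set i in codom (pivot J)].
have cardS : #|S| = (n - r)%N.
  rewrite cardsCs finset.setCK cardsE card_ord card_codom ?card_ord //; exact: pivot_inj.
have le_rn : (r <= n)%N by rewrite -(eqP J) rank_leq_col.
suff : (#|S| + d <= n)%N by rewrite cardS -leq_subRL ?leq_subr // subKn.
apply: (@prime_chain_bound _ _ (fun k => vanishing (T k))) => [k lekd|k ltkd|].
- by apply: vanishing_prime; case: (irrT k lekd).
- have [sub nsub] := ltT k ltkd; split=> [q qT y /sub|sub']; first exact: qT.
  apply: nsub; have [cT _] := irrT _ (ltnW ltkd); have [cT' _] := irrT _ ltkd.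
  by rewrite -(zeros_vanishing cT) -(zeros_vanishing cT') => y yT q /sub'; apply: yT.
move=> q qE; rewrite T0 vanishing_zeros //; apply: local_prime_free => //.
rewrite -[RHS]qE; apply: (@mmap_eq _ _ _ (@mpolyC n K)) => i.
by rewrite /keep !inE; case: ifP.
Qed.

(** The tangent space is the kernel of the Jacobian: equations of L lie in P_r, where gradients at x
    are combinations of those of h. *)
Lemma local_tangent : exists T : {vspace 'rV[K]_n},
  (forall v, v \in T <-> tangent_space L x v) /\ (\dim T + r)%N = n.
Proof.
pose f : 'Hom('rV[K]_n, 'rV[K]_r) := linfun (mulmxr (jacobian_mx (x 0) (tnth h))^T).
have fE v j : f v 0 j = \sum_i (tnth h j)^`M(i).@[x 0] * v 0 i.
  by rewrite lfunE /= mxE; apply: eq_bigr => i _; rewrite !mxE mulrC.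
exists (lker f); split=> [v|].
  rewrite memv_ker; split=> [/eqP/rowP fv0 q qL|vT]; last first.
    apply/eqP/rowP => j; rewrite fE mxE; apply: vT => y Ly; exact: h0.
  have Pq : P r q.
    by rewrite -vanishing_local => y [/zeros_sub yh nZ]; apply: qL.
  have [l lE] := local_prime_gradient hx Pq.
  under eq_bigr => i _ do rewrite lE mulr_suml.
  rewrite exchange_big big1 // => j _ /=.
  under eq_bigr => i _ do rewrite -mulrA.
  by rewrite -mulr_sumr -fE fv0 mxE mulr0.
have fsurj : limg f = fullv.
  apply/vspaceP => w; rewrite memvf; apply/memv_imgP.
  have /row_fullP[B BJ] : row_full (jacobian_mx (x 0) (tnth h))^T.
    by rewrite /row_full mxrank_tr; apply: J.
  by exists (w *m B); rewrite ?memvf // lfunE /= -mulmxA BJ mulmx1.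
have := limg_ker_dim f fullv; rewrite capfv fsurj !dimvf.
by rewrite /dim /= !mul1n.
Qed.

End AtPoint.

Lemma smooth_complete_intersection : smooth_variety r L.
Proof.
split=> [|X cX|x Lx]; last exact: local_tangent.
  by exists (zeros [set` h]), Z; split=> //; apply: zeros_zclosed.
have [XL [[x Xx] _] _] := cX.
by rewrite (local_component (XL _ Xx) cX Xx); apply: local_codim; apply: XL.
Qed.

End SmoothCompleteIntersection.

(** * Derivations of algebraic extensions *)

Record derivation (A : pzRingType) (d : A -> A) : Prop := Derivation {
  derivationD : forall a b, d (a + b) = d a + d b;
  derivationM : forall a b, d (a * b) = d a * b + a * d b }.

Section DerivationTheory.
Variables (A : pzRingType) (d : A -> A).
Hypothesis hd : derivation d.

Lemma derivation0 : d 0 = 0.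
Proof. by apply: (addrI (d 0)); rewrite -(derivationD hd) !addr0. Qed.

Lemma derivation1 : d 1 = 0.
Proof.
by apply: (addrI (d 1)); rewrite addr0 -{3}[1]mulr1 (derivationM hd) mulr1 mul1r.
Qed.

Lemma derivationN a : d (- a) = - d a.
Proof. by apply: (addrI (d a)); rewrite -(derivationD hd) !subrr derivation0. Qed.

Lemma derivation_sum (I : Type) (r : seq I) (P : pred I) (F : I -> A) :
  d (\sum_(i <- r | P i) F i) = \sum_(i <- r | P i) d (F i).
Proof. exact: (big_morph _ (derivationD hd) derivation0). Qed.

Lemma derivation_nat k : d k%:R = 0.
Proof.
elim: k => [|k IHk]; first exact: derivation0.
by rewrite -addn1 natrD (derivationD hd) IHk derivation1 // addr0.
Qed.

End DerivationTheory.

Lemma fraction_repr (A : idomainType) (u : {fraction A}) :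
  exists p q, q != 0 /\ u * tofrac q = tofrac p.
Proof.
elim/quotW: u => u; exists u.1, u.2; split; first exact: denom_ratioP.
unlock FracField.tofrac; rewrite -[LHS]FracField.pi_mul.
apply/eqP; rewrite FracField.equivf_def /FracField.mulf.
by rewrite !numden_Ratio ?mulf_neq0 ?oner_eq0 ?denom_ratioP // !mulr1 mulrC.
Qed.

Lemma fraction_derivation (A : idomainType) (d : A -> A) : derivation d ->
  exists2 D : {fraction A} -> {fraction A}, derivation D &
    forall a, D (tofrac a) = tofrac (d a).
Proof.
move=> hd.
have reprP (u : {fraction A}) : exists pq : A * A, pq.2 != 0 /\ u * tofrac pq.2 = tofrac pq.1.
  by have [p [q [q0 E]]] := fraction_repr u; exists (p, q).
have [nd ndP] := choice reprP.
pose D u := (tofrac (d (nd u).1) - u * tofrac (d (nd u).2)) / tofrac (nd u).2.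
(* The quotient rule holds for every representation of u, not just for the chosen one; sums and
   products can then be computed over a common denominator. *)
have DE u p q : q != 0 -> u * tofrac q = tofrac p ->
    D u * tofrac q = tofrac (d p) - u * tofrac (d q).
  move=> q0 E; have [] := ndP u; set n := (nd u).1; set m := (nd u).2 => m0 E'.
  have m0' : tofrac m != 0 by rewrite tofrac_eq0.
  have cross : n * q = p * m.
    by apply/eqP; rewrite -tofrac_eq !tofracM -E -E'; apply/eqP; ring.
  have := congr1 (fun a => tofrac (d a)) cross.
  rewrite !(derivationM hd) !tofracD !tofracM -E -E' => dcross.
  apply: (mulIf m0'); rewrite /D -/n -/m mulrAC divfK //.
  have -> : (tofrac (d n) - u * tofrac (d m)) * tofrac q =
    (tofrac (d n) * tofrac q + u * tofrac m * tofrac (d q)) -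
    u * tofrac (d m) * tofrac q - u * tofrac m * tofrac (d q) by ring.
  by rewrite dcross; ring.
exists D => [|a]; last first.
  have := DE (tofrac a) a 1; rewrite oner_eq0 tofrac1 !mulr1 (derivation1 hd) tofrac0.
  by rewrite mulr0 subr0; apply.
split=> u v; have [p [q [q0 Eu]]] := fraction_repr u;
  have [p' [q' [q'0 Ev]]] := fraction_repr v;
  have tq0 : tofrac (q * q') != 0 by rewrite tofrac_eq0 mulf_neq0.
  have E : (u + v) * tofrac (q * q') = tofrac (p * q' + p' * q).
    by rewrite tofracD !tofracM -Eu -Ev; ring.
  apply: (mulIf tq0); rewrite (DE _ _ _ _ E) ?mulf_neq0 //.
  rewrite (derivationD hd) !(derivationM hd) !(tofracD, tofracM) -Eu -Ev.
  have -> : (D u + D v) * (tofrac q * tofrac q') =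
    D u * tofrac q * tofrac q' + D v * tofrac q' * tofrac q by ring.
  by rewrite (DE _ _ _ q0 Eu) (DE _ _ _ q'0 Ev); ring.
have E : (u * v) * tofrac (q * q') = tofrac (p * p').
  by rewrite !tofracM -Eu -Ev; ring.
apply: (mulIf tq0); rewrite (DE _ _ _ _ E) ?mulf_neq0 //.
rewrite !(derivationM hd) !(tofracD, tofracM) -Eu -Ev.
have -> : (D u * v + u * D v) * (tofrac q * tofrac q') =
  D u * tofrac q * (v * tofrac q') + D v * tofrac q' * (u * tofrac q) by ring.
by rewrite (DE _ _ _ q0 Eu) (DE _ _ _ q'0 Ev); ring.
Qed.

Section AlgebraicDerivation.
Variables (F L : fieldType) (iota : {rmorphism F -> L}).
Hypothesis charF : [pchar F] =i pred0.
Hypothesis algL : integralRange iota.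
Variable d : F -> F.
Hypothesis hd : derivation d.

Local Notation "p ^i" := (map_poly iota p) (at level 2, format "p ^i").
Let dp (p : {poly F}) : {poly F} := map_poly d p.

Let coef_dp p i : (dp p)`_i = d p`_i.
Proof. by rewrite coef_map_id0 // derivation0. Qed.

Let derivation_dp : derivation dp.
Proof.
split=> p q; apply/polyP => i; rewrite ?coefD !coef_dp ?coefD ?(derivationD hd) //.
rewrite !coefM (derivation_sum hd) -big_split; apply: eq_bigr => j _.
by rewrite (derivationM hd) !coef_dp.
Qed.

Let dpC c : dp c%:P = (d c)%:P.
Proof.
by apply/polyP => i; rewrite coef_dp !coefC; case: eqP; rewrite ?(derivation0 hd).
Qed.

Let dpX : dp 'X = 0.
Proof.
apply/polyP => i; rewrite coef_dp coefX coef0; case: eqP => _.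
  exact: derivation1.
exact: derivation0.
Qed.

Let dp_comp p q : dp (p \Po q) = dp p \Po q + (p^`() \Po q) * dp q.
Proof.
elim/poly_ind: p => [|p c IHp].
  by rewrite comp_poly0 deriv0 (derivation0 derivation_dp) !comp_poly0 mul0r addr0.
rewrite comp_poly_MXaddC (derivationD derivation_dp) (derivationM derivation_dp) IHp.
rewrite (derivationD derivation_dp) (derivationM derivation_dp) dpX mulr0 addr0 !dpC.
rewrite derivD derivM derivC derivX addr0 mulr1.
by rewrite !(comp_polyD, comp_polyM, comp_polyX, comp_polyC); ring.
Qed.

(** This is the minimal polynomial of z, up to a constant factor; characteristic zero makes it
    separable. *)
Let annihilator z : exists m : {poly F}, [/\ m^i.[z] = 0, m^`()^i.[z] != 0 &
  forall p, p^i.[z] = 0 -> m %| p].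
Proof.
have [p0 mon_p0 /rootP p0z] := algL z.
pose s k := `[< exists p : {poly F}, [/\ p != 0, p^i.[z] = 0 & size p = k] >].
have ex_s : exists k, s k.
  by exists (size p0); apply/asboolP; exists p0; rewrite monic_neq0.
case: (ex_minnP ex_s) => k /asboolP[m [m0 mz <-]] min_m; exists m.
have minP p : p^i.[z] = 0 -> (size p < size m)%N -> p = 0.
  move=> pz lt_pm; apply/eqP; apply: contraTT lt_pm => p_neq0; rewrite -leqNgt.
  by apply: min_m; apply/asboolP; exists p.
split=> // [|p pz]; last first.
  apply/eqP/minP; last exact: ltn_modpN0.
  have -> : p %% m = p - p %/ m * m by rewrite {2}(divp_eq p m) addrC addKr.
  by rewrite rmorphB rmorphM /= hornerD hornerN hornerM mz pz mulr0 subr0.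
have lt1m : (1 < size m)%N.
  rewrite ltnNge; apply/negP => /size1_polyC mE.
  move: mz m0; rewrite mE map_polyC hornerC /= => /eqP; rewrite fmorph_eq0 => /eqP ->.
  by rewrite polyC0 eqxx.
apply/eqP => m'z; have := minP _ m'z (lt_size_deriv m0).
move=> /(congr1 (fun f : {poly F} => f`_(size m).-2)); rewrite coef_deriv coef0.
have -> : (size m).-2.+1 = (size m).-1 by rewrite prednK // -ltnS prednK // ltnW.
move=> /eqP; rewrite -mulr_natr mulf_eq0 -lead_coefE lead_coef_eq0 (negPf m0) /=.
by have /pcharf0P -> := charF; case: (size m) lt1m => [|[]].
Qed.

(** Differentiating m(z) = 0 forces D z = - (dm)(z) / m'(z). Additivity and the Leibniz rule are
    checked by writing both arguments as polynomials in a primitive element. *)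
Lemma algebraic_derivation : exists2 D : L -> L, derivation D &
  forall c, D (iota c) = iota (d c).
Proof.
have [mu muP] := choice annihilator.
pose D z := - ((dp (mu z))^i.[z] / (mu z)^`()^i.[z]).
have DE z p : p^i.[z] = 0 -> (dp p)^i.[z] + p^`()^i.[z] * D z = 0.
  have [mz m'z mdiv] := muP z; move/mdiv/dvdpP => [q ->].
  rewrite (derivationM derivation_dp) derivM !rmorphD !rmorphM /= !hornerD !hornerM mz.
  have -> : (dp (mu z))^i.[z] = - (mu z)^`()^i.[z] * D z.
    by rewrite /D mulrNN mulrC divfK.
  by ring.
(* The values of D at z and at w = p(z) come from different minimal polynomials. They are compared
   through the composite of the minimal polynomial of w with p, which annihilates z. *)
have Dp z p : D p^i.[z] = (dp p)^i.[z] + p^`()^i.[z] * D z.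
  set w := p^i.[z]; have [mw m'w _] := muP w.
  have Ew q : (q \Po p)^i.[z] = q^i.[w] by rewrite map_comp_poly horner_comp.
  have := DE z (mu w \Po p); rewrite Ew => /(_ mw).
  rewrite dp_comp deriv_comp rmorphD !rmorphM /= hornerD !hornerM !Ew.
  rewrite -addrA -mulrA -mulrDr => /eqP; rewrite addrC addr_eq0 => /eqP E.
  apply: (mulfI m'w); rewrite E /D mulrN; congr (- _).
  by rewrite mulrC divfK.
exists D => [|c]; last first.
  have := Dp 0 c%:P; rewrite map_polyC hornerC derivC map_poly0 horner0 mul0r addr0.
  by rewrite dpC map_polyC hornerC.
have pet x y : exists z p q, p^i.[z] = x /\ q^i.[z] = y.
  have [p mon_p px] := algL x; have [q mon_q qy] := algL y.
  have [k [[p' px'] [q' qy']]] := pchar0_PET (monic_neq0 mon_p) px (monic_neq0 mon_q) qy charF.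
  by exists (y *+ k - x), p', q'.
split=> x y; have [z [p [q [<- <-]]]] := pet x y.
  rewrite -hornerD -rmorphD !Dp (derivationD derivation_dp) derivD !rmorphD /=.
  by rewrite !hornerD; ring.
rewrite -hornerM -rmorphM !Dp (derivationM derivation_dp) derivM !rmorphD !rmorphM /=.
by rewrite !hornerD !hornerM; ring.
Qed.

End AlgebraicDerivation.

(** L is an algebraic closure of the fraction field. Since [countable_algebraic_closure] takes a
    countable field, fractions are coded by lists of monomials and coefficients. *)
Lemma mpoly_rat_closure N : exists (L : closedFieldType)
    (iota : {rmorphism {mpoly rat[N]} -> L}), injective iota /\
  forall i, exists2 D : L -> L, derivation D &
    forall q, D (iota q) = iota q^`M(i).
Proof.
pose A := {mpoly rat[N]}; pose F := {fraction A}.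
pose enc (q : A) := [seq (m, q@_m) | m <- msupp q].
pose dec (s : seq ('X_{1..N} * rat)) : A := \sum_(c <- s) c.2 *: 'X_[c.1].
have encK : cancel enc dec by move=> q; rewrite /dec big_map -mpolyE.
have [nd ndK] : exists nd : F -> A * A, cancel nd (fun pq => tofrac pq.1 / tofrac pq.2).
  have /choice[nd ndP] : forall u : F, exists pq : A * A, tofrac pq.1 / tofrac pq.2 = u.
    move=> u; have [p [q [q0 E]]] := fraction_repr u; exists (p, q).
    by rewrite /= -E mulfK // tofrac_eq0.
  by exists nd.
pose encF (u : F) := (enc (nd u).1, enc (nd u).2).
have encFK : cancel encF (fun st => tofrac (dec st.1) / tofrac (dec st.2)).
  by move=> u; rewrite /= !encK ndK.
pose Fcount : countFieldType := HB.pack F (CanIsCountable encFK).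
have [L [j algL]] := countable_algebraic_closure Fcount.
exists L, (j \o (@FracField.tofrac A)); split.
  by move=> p q /= /fmorph_inj/eqP; rewrite tofrac_eq => /eqP.
have charF : [pchar Fcount] =i pred0.
  apply/pcharf0P => k; have -> : k%:R = tofrac (k%:R : A) :> Fcount by rewrite rmorph_nat.
  by rewrite tofrac_eq0 -(rmorph_nat (@mpolyC N rat)) mpolyC_eq0 Num.Theory.pnatr_eq0.
move=> i; have hd : derivation (mderiv i : A -> A).
  by split=> p q; [apply: mderivD|apply: mderivM].
have [DF hDF DFE] := fraction_derivation hd.
have [D hD DE] := algebraic_derivation (d := DF : Fcount -> Fcount) charF algL hDF.
by exists D => // q /=; rewrite DE DFE.
Qed.

(** * Bordered minors *)

Lemma row_free_minorP (K : fieldType) (m n : nat) (M : 'M[K]_(m, n)) :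
  row_free M <-> exists c : 'I_m -> 'I_n, \det (colsub c M) != 0.
Proof.
split=> [freeM|[c detc]].
  have fullM : row_full M^T by rewrite /row_full mxrank_tr.
  exists (fullrankfun fullM); rewrite -unitfE -unitmxE -unitmx_tr.
  have -> : (colsub (fullrankfun fullM) M)^T = rowsub (fullrankfun fullM) M^T.
    by apply/matrixP => i j; rewrite !mxE.
  exact: fullrowsub_unit.
rewrite -kermx_eq0; apply/rowV0P => v /sub_kermxP vM0.
have /row_free_inj inj : row_free (colsub c M) by rewrite row_free_unit unitmxE unitfE.
by apply: inj; rewrite mul0mx mulmx_colsub vM0; apply/matrixP => i j; rewrite !mxE.
Qed.

Lemma mulmx_col (R : pzSemiRingType) (m n p : nat) (A : 'M[R]_(m, n)) (B : 'M_(n, p)) i j :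
  (A *m col j B) i 0 = (A *m B) i j.
Proof. by rewrite !mxE; apply: eq_bigr => k _; rewrite [in LHS]mxE. Qed.

Section BorderedMinors.
Variables (R : comNzRingType) (n p : nat).
Hypothesis le_pn : (p.+1 <= n)%N.
Implicit Types (M : 'M[R]_(p.+1, n)) (w : 'cV[R]_p.+1).

Definition bordered M w : 'M[R]_p.+1 :=
  \matrix_(k, b) if (b < p)%N then M k (widen_ord le_pn b) else w k 0.

(** These are the coefficients of the bordered determinant as a linear form in its last column; they
    do not involve that column, so 0 is put there. *)
Definition cofactors M : 'rV[R]_p.+1 :=
  \row_k cofactor (bordered M 0) k ord_max.

Lemma det_bordered M w : \det (bordered M w) = (cofactors M *m w) 0 0.
Proof.
rewrite (expand_det_col _ ord_max) mxE; apply: eq_bigr => k _.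
rewrite !mxE /= ltnn mulrC; congr (_ * _); congr (_ * \det _).
by apply/matrixP => a b; rewrite !mxE lift_max ltn_ord.
Qed.

Lemma det_border_cols M (j : 'I_n) :
  \det (colsub (fun k : 'I_p.+1 => if (k < p)%N then widen_ord le_pn k else j) M) =
  (cofactors M *m M) 0 j.
Proof.
transitivity (\det (bordered M (col j M))).
  congr (\det _); apply/matrixP => a b; rewrite !mxE.
  by case: ifP => //; rewrite mxE.
by rewrite det_bordered mulmx_col.
Qed.

(** Where m is nonzero the cofactor row is thus nonzero. The sign is +1 because the entry lies on
    the diagonal. *)
Lemma cofactors_max M : cofactors M 0 ord_max =
  \det (mxsub (widen_ord (leq_pred p.+1))
              (widen_ord (leq_trans (leq_pred p.+1) le_pn)) M).
Proof.
rewrite mxE /cofactor addnn -signr_odd odd_double mul1r; congr (\det _).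
apply/matrixP => a b; rewrite !mxE lift_max ltn_ord.
by congr (M _ _); apply: val_inj; rewrite /= /bump leqNgt ltn_ord.
Qed.

End BorderedMinors.

Lemma map_cofactors (R S : comNzRingType) (f : {rmorphism R -> S}) n p
    (le_pn : (p.+1 <= n)%N) (M : 'M[R]_(p.+1, n)) :
  map_mx f (cofactors le_pn M) = cofactors le_pn (map_mx f M).
Proof.
apply/rowP => k; rewrite !mxE -cofactor_map_mx; congr (cofactor _ _ _).
by apply/matrixP => a b; rewrite !mxE; case: ifP => _; rewrite ?rmorph0.
Qed.

Section VanishingMinors.
Variables (K : fieldType) (n p : nat).
Hypothesis le_pn : (p.+1 <= n)%N.
Implicit Types (M : 'M[K]_(p.+1, n)).

Lemma cofactors_mul_low M (j : 'I_n) : (j < p)%N -> (cofactors le_pn M *m M) 0 j = 0.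
Proof.
move=> ltjp; rewrite -det_border_cols -det_tr.
apply: (determinant_alternate (i1 := Ordinal (leqW ltjp)) (i2 := ord_max)).
  by rewrite -val_eqE /= ltn_eqF.
move=> k; rewrite !mxE /= ltjp ltnn; congr (M _ _); exact: val_inj.
Qed.

(* The cofactor row is a left kernel vector of every column on which the
   bordered minor vanishes. *)
Lemma minor0_of_cofactors M (c : 'I_p.+1 -> 'I_n) : cofactors le_pn M 0 ord_max != 0 ->
  (forall k, (cofactors le_pn M *m M) 0 (c k) = 0) -> \det (colsub c M) = 0.
Proof.
move=> m0 cM0; apply/eqP/det0P; exists (cofactors le_pn M).
  by apply: contraNneq m0 => ->; rewrite mxE.
by rewrite mulmx_colsub; apply/rowP => k; rewrite mxE cM0 mxE.
Qed.

(** The first p columns of M bordered by column l of w form an invertible matrix, and all its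
    columns lie in the column space of w. *)
Lemma row_free_of_cofactors M (w : 'M[K]_(p.+1, n)) (A : 'M[K]_n) l :
  w *m A = M -> (cofactors le_pn M *m w) 0 l != 0 -> row_free w.
Proof.
move=> wA cw0; rewrite -kermx_eq0; apply/rowV0P => v /sub_kermxP vw0.
have /row_free_inj inj : row_free (bordered le_pn M (col l w)).
  by rewrite row_free_unit unitmxE unitfE det_bordered mulmx_col.
apply: inj; rewrite mul0mx; apply/rowP => b; rewrite !mxE.
have vM0 : v *m M = 0 by rewrite -wA mulmxA vw0 mul0mx.
case: (ltnP b p) => [ltb|leb].
  have := congr1 (fun u : 'rV_n => u 0 (widen_ord le_pn b)) vM0; rewrite !mxE => E.
  by rewrite -[RHS]E; apply: eq_bigr => k _; rewrite mxE ltb.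
have := congr1 (fun u : 'rV_n => u 0 l) vw0; rewrite !mxE => E.
by rewrite -[RHS]E; apply: eq_bigr => k _; rewrite mxE ltnNge leb /= mxE.
Qed.

End VanishingMinors.

(** * The generic matrix *)

Lemma mderiv_map_mpoly (R S : comNzRingType) (f : {rmorphism R -> S}) n j
    (q : {mpoly R[n]}) : (map_mpoly f q)^`M(j) = map_mpoly f q^`M(j).
Proof.
elim/mpoly_ring_ind: q => [c|i|p q Ep Eq|p q Ep Eq].
- by rewrite map_mpolyC !mderivC rmorph0.
- by rewrite /map_mpoly mmapXU !mderivXU rmorph_nat.
- by rewrite rmorphD !mderivD Ep Eq rmorphD.
- by rewrite rmorphM !mderivM Ep Eq rmorphD !rmorphM.
Qed.

Section ChainRule.
Variables (R : comNzRingType) (L : comNzRingType) (n : nat).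
Variables (iota : {rmorphism R -> L}) (y : 'I_n -> L) (d : L -> L).
Hypothesis hd : derivation d.
Implicit Types (q : {mpoly R[n]}).

(* The chain rule without the derivatives of the coefficients: these are then
   killed by d. *)
Definition chain q := d (mmap iota y q) = \sum_j mmap iota y q^`M(j) * d (y j).

Lemma chainC c : d (iota c) = 0 -> chain c%:MP.
Proof.
by move=> dc; rewrite /chain mmapC dc big1 // => j _; rewrite mderivC rmorph0 mul0r.
Qed.

Lemma chainX i : chain 'X_i.
Proof.
rewrite /chain mmapXU (bigD1 i) //= big1 => [|j /negPf ji].
  by rewrite mderivXU eqxx rmorph1 mul1r addr0.
by rewrite mderivXU eq_sym ji rmorph0 mul0r.
Qed.

Lemma chainD p q : chain p -> chain q -> chain (p + q).
Proof.
rewrite /chain => Ep Eq; rewrite rmorphD (derivationD hd) Ep Eq -big_split.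
by apply: eq_bigr => j _; rewrite mderivD rmorphD mulrDl.
Qed.

Lemma chainM p q : chain p -> chain q -> chain (p * q).
Proof.
rewrite /chain => Ep Eq; rewrite rmorphM (derivationM hd) Ep Eq mulr_suml mulr_sumr.
rewrite -big_split; apply: eq_bigr => j _.
by rewrite mderivM rmorphD !rmorphM mulrDl mulrAC mulrA.
Qed.

Lemma chain_nat k : chain k%:R.
Proof.
rewrite -(rmorph_nat (@mpolyC n R)); apply: chainC.
by rewrite rmorph_nat derivation_nat.
Qed.

Lemma chain_sum (I : Type) (r : seq I) (F : I -> {mpoly R[n]}) :
  (forall i, chain (F i)) -> chain (\sum_(i <- r) F i).
Proof.
move=> cF; elim/big_ind: _ => //; [exact: (chain_nat 0)|exact: chainD].
Qed.

Lemma chain_sign k : chain ((-1) ^+ k).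
Proof.
elim: k => [|k IHk]; first exact: (chain_nat 1).
rewrite exprS; apply: chainM => //; rewrite -[-1](rmorphN1 (@mpolyC n R)).
by apply: chainC; rewrite rmorphN1 (derivationN hd) (derivation1 hd) oppr0.
Qed.

Lemma chain_det m (M : 'M[{mpoly R[n]}]_m) :
  (forall i j, chain (M i j)) -> chain (\det M).
Proof.
move=> cM; apply: chain_sum => s; apply: chainM.
  exact: chain_sign.
elim/big_ind: _ => //; [exact: (chain_nat 1)|exact: chainM].
Qed.

End ChainRule.

Section GenericMatrix.
Variables (n p : nat).
Hypothesis le_pn : (p.+1 <= n)%N.
Variable g : 'I_p.+1 -> {mpoly rat[n]}.
Local Notation A := {mpoly rat[n * n]}.

Definition gen_poly : {rmorphism {mpoly rat[n]} -> {mpoly A[n]}} :=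
  map_mpoly (@mpolyC (n * n) rat).

Definition gen_jacobian : 'M[{mpoly A[n]}]_(p.+1, n) :=
  \matrix_(k, j) (gen_poly (g k))^`M(j).

Definition gen_mx : 'M[{mpoly A[n]}]_n :=
  \matrix_(l, j) ('X_(mxvec_index l j))%:MP.

(* In the coordinates y = A x, the bordered minor M_t is the value at the
   t-th column of A of a linear form that depends on y and on the first p
   columns of A only. *)
Definition gen_form : 'rV[{mpoly A[n]}]_n :=
  cofactors le_pn (gen_jacobian *m gen_mx) *m gen_jacobian.

Definition gen_minor (t : 'I_n) : {mpoly A[n]} := (gen_form *m gen_mx) 0 t.

Definition gen_polar i (tau : 'I_i -> 'I_n) : 'M[{mpoly A[n]}]_(p.+1 + i, n) :=
  col_mx gen_jacobian (\matrix_(t, j) (gen_minor (tau t))^`M(j)).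

Section GenericPoint.
Variables (L : fieldType) (iota : {rmorphism A -> L}) (y : 'I_n -> L).
Hypothesis derL : forall k, exists2 D : L -> L, derivation D &
  forall q, D (iota q) = iota q^`M(k).
Local Notation ev := (mmap iota y).

Lemma gen_jacobian_row_free l :
  ev (gen_form 0 l) != 0 -> row_free (map_mx ev gen_jacobian).
Proof.
move=> om0; apply: (@row_free_of_cofactors _ _ _ le_pn
  (map_mx ev (gen_jacobian *m gen_mx)) _ (map_mx ev gen_mx) l).
  by rewrite map_mxM.
rewrite -map_cofactors -map_mxM mxE; exact: om0.
Qed.

Section OneDirection.
Variables (l0 t0 : 'I_n) (D : L -> L).
Hypothesis hD : derivation D.
Hypothesis DE : forall q, D (iota q) = iota q^`M(mxvec_index l0 t0).
Hypothesis le_pt0 : (p <= t0)%N.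

Lemma chain_gen_poly q : chain iota y D (gen_poly q).
Proof.
elim/mpoly_ring_ind: q => [c|i|q r Eq Er|q r Eq Er].
- by rewrite /= map_mpolyC; apply: chainC; rewrite DE mderivC rmorph0.
- by rewrite /= /map_mpoly mmapXU; apply: chainX.
- by rewrite rmorphD; apply: chainD.
- by rewrite rmorphM; apply: chainM.
Qed.

Lemma D_gen_mx l t :
  D (iota 'X_(mxvec_index l t)) = ((l == l0) && (t == t0))%:R.
Proof.
rewrite DE mderivXU rmorph_nat; congr (nat_of_bool _)%:R.
apply/eqP/andP => [|[/eqP -> /eqP ->]] //.
by move=> /cast_ord_inj/enum_rank_inj[-> ->].
Qed.

(** The entries of A that occur in omega belong to the first p columns, and D kills them because t0
    is at least p. *)
Lemma chain_gen_form l : chain iota y D (gen_form 0 l).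
Proof.
have cJ k j : chain iota y D (gen_jacobian k j).
  by rewrite mxE mderiv_map_mpoly; apply: chain_gen_poly.
rewrite mxE; apply: chain_sum => // k; apply: chainM => //.
rewrite mxE /cofactor; apply: chainM => //.
  exact: chain_sign.
apply: chain_det => // a b; rewrite 3!mxE lift_max ltn_ord mxE.
apply: chain_sum => // j; apply: chainM => //; rewrite mxE; apply: chainC.
rewrite D_gen_mx; case: eqP => //= _; case: eqP => //= E.
by move: le_pt0; rewrite -E leqNgt /= /bump [(p <= b)%N]leqNgt ltn_ord add0n ltn_ord.
Qed.

(** M_t(y) is the value of omega(y) at a_t. Differentiating it gives the part through y, which is
    the sum, and an explicit part, which is omega_(l0) for t = t0 and 0 otherwise. *)
Lemma gen_minor_direction t : ev (gen_minor t) = 0 ->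
  \sum_j ev (gen_minor t)^`M(j) * D (y j) = - (ev (gen_form 0 l0) *+ (t == t0)).
Proof.
move=> Et; have mderivE j : (gen_minor t)^`M(j) =
    \sum_l (gen_form 0 l)^`M(j) * gen_mx l t.
  rewrite /gen_minor mxE (raddf_sum (mderiv j)); apply: eq_bigr => l _ /=.
  by rewrite mderivM [gen_mx l t]mxE mderivC mulr0 addr0.
have : D (ev (gen_minor t)) =
    \sum_j ev (gen_minor t)^`M(j) * D (y j) + ev (gen_form 0 l0) *+ (t == t0).
  rewrite {1}/gen_minor mxE rmorph_sum (derivation_sum hD).
  under eq_bigr => l _ do rewrite rmorphM (derivationM hD) chain_gen_form.
  rewrite big_split /=; congr (_ + _).
    under [RHS]eq_bigr => j _ do rewrite mderivE rmorph_sum mulr_suml.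
    rewrite [RHS]exchange_big; apply: eq_bigr => l _ /=.
    by rewrite mulr_suml; apply: eq_bigr => j _; rewrite rmorphM mulrAC.
  rewrite (bigD1 l0) //= big1 => [|l /negPf ll0].
    by rewrite [gen_mx _ _]mxE mmapC D_gen_mx eqxx addr0 mulr_natr.
  by rewrite [gen_mx _ _]mxE mmapC D_gen_mx ll0 mulr0.
by rewrite Et (derivation0 hD) => /esym/eqP; rewrite addr_eq0 => /eqP.
Qed.

End OneDirection.

(** A left kernel vector (a, b) is paired with w = D(y), for D in the direction (l0, tau t0). Since
    g(y) = 0 gives J w = 0, and the M-block sends w to a nonzero multiple of the t0-th unit vector,
    b vanishes at t0; independence of the rows of J then gives a = 0. *)
Lemma gen_polar_row_free i (tau : 'I_i -> 'I_n) l0 :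
  injective tau -> (forall t, (p <= tau t)%N) ->
  (forall k, ev (gen_poly (g k)) = 0) -> (forall t, ev (gen_minor (tau t)) = 0) ->
  ev (gen_form 0 l0) != 0 -> row_free (map_mx ev (gen_polar tau)).
Proof.
move=> tau_inj le_ptau g0 E0 om0; have freeJ := gen_jacobian_row_free om0.
rewrite /gen_polar map_col_mx; set J := map_mx ev gen_jacobian in freeJ *.
set E := map_mx ev _; rewrite -kermx_eq0; apply/rowV0P => v /sub_kermxP.
rewrite -[v]hsubmxK mul_row_col; set a := lsubmx v; set b := rsubmx v => vM0.
have b0 : b = 0.
  apply/rowP => t0; rewrite [RHS]mxE.
  have [D hD DE] := derL (mxvec_index l0 (tau t0)).
  pose w : 'cV[L]_n := \col_j D (y j).
  have Jw : J *m w = 0.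
    apply/colP => k; rewrite !mxE; transitivity (D (ev (gen_poly (g k)))).
      by rewrite (chain_gen_poly hD DE); apply: eq_bigr => j _; rewrite !mxE.
    by rewrite g0 (derivation0 hD).
  have Ew t : (E *m w) t 0 = - (ev (gen_form 0 l0) *+ (t == t0)).
    rewrite -(inj_eq tau_inj) -(gen_minor_direction hD DE (le_ptau t0) (E0 t)) mxE.
    by apply: eq_bigr => j _; rewrite !mxE.
  have : (b *m (E *m w)) 0 0 = 0.
    have := congr1 (fun M : 'rV_n => (M *m w) 0 0) vM0.
    by rewrite mulmxDl -!mulmxA Jw mulmx0 add0r mul0mx [in RHS]mxE.
  rewrite [LHS]mxE (bigD1 t0) //= big1 => [|t /negPf tt0]; last first.
    by rewrite Ew tt0 oppr0 mulr0.
  rewrite Ew eqxx addr0 => /eqP; rewrite mulrN oppr_eq0 mulf_eq0 (negPf om0) orbF.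
  by move/eqP.
move: vM0; rewrite b0 mul0mx addr0 => aJ0.
have a0 : a = 0 by apply: (row_free_inj freeJ); rewrite mul0mx.
by rewrite a0 row_mx0.
Qed.

End GenericPoint.

(** The common zeros form the bad locus, where the polar equations hold and their Jacobian drops
    rank. Finite functions index the minors so that they form a list. *)
Definition gen_system i (tau : 'I_i -> 'I_n) : seq {mpoly A[n]} :=
  [seq gen_poly (g k) | k <- enum 'I_p.+1] ++
  [seq gen_minor (tau t) | t <- enum 'I_i] ++
  [seq \det (colsub c (gen_polar tau)) | c : {ffun 'I_(p.+1 + i) -> 'I_n} <- enum {ffun 'I_(p.+1 + i) -> 'I_n}].

Lemma gen_certificate i (tau : 'I_i -> 'I_n) l :
  injective tau -> (forall t, (p <= tau t)%N) ->
  exists Phi : A, Phi != 0 /\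
    exists k, gen_ideal (gen_system tau) (Phi%:MP * gen_form 0 l ^+ k).
Proof.
move=> tau_inj le_ptau; apply: contrapT => nex.
have [L [iota [iota_inj derL]]] := mpoly_rat_closure (n * n).
(* Avoiding the nonzero elements of Q[A] makes the prime contract to 0 there, so its zeros lie over
   the generic matrix; avoiding the powers of omega_l provides a zero at which omega_l is
   nonzero. *)
pose M := [set q : {mpoly A[n]} | exists (Phi : A) k, Phi != 0 /\ q = Phi%:MP * gen_form 0 l ^+ k].
have [|_ _ [Phi [k [Phi0 ->]]] [Psi [m [Psi0 ->]]]|q Iq [Phi [k [Phi0 E]]]|P [primeP IP PM]] :=
  prime_avoiding (gen_ideal_ideal (gen_system tau)) (M := M).
- by exists 1, 0%N; rewrite oner_eq0 expr0 mpolyC1 mulr1.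
- exists (Phi * Psi), (k + m)%N; rewrite mulf_neq0 //; split=> //.
  by rewrite mpolyCM exprD mulrACA.
- by apply: nex; exists Phi; split=> //; exists k; rewrite -E.
have Pc c : P c%:MP <-> iota c = 0.
  split=> [Pc|ic].
    have [->|c0] := eqVneq c 0; first by rewrite rmorph0.
    by case: (PM _ Pc); exists c, 0%N; rewrite expr0 mulr1.
  have -> : c = 0 by apply: iota_inj; rewrite ic rmorph0.
  by rewrite mpolyC0; apply: ideal_set0 (prime_ideal primeP).
have nPom : ~ P (gen_form 0 l).
  by move=> /PM[]; exists 1, 1%N; rewrite oner_eq0 mpolyC1 mul1r.
have [y [yP yom]] := nullstellensatz primeP Pc nPom.
have ev0 q : q \in gen_system tau -> mmap iota y q = 0.
  by move=> Sq; apply/yP/IP/gen_ideal_mem.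
have : row_free (map_mx (mmap iota y) (gen_polar tau)).
  apply: (gen_polar_row_free derL tau_inj le_ptau _ _ yom) => [k|t]; apply: ev0.
    by rewrite mem_cat; apply/orP; left; apply/mapP; exists k; rewrite ?mem_enum.
  rewrite !mem_cat; apply/orP; right; apply/orP; left.
  by apply/mapP; exists t; rewrite ?mem_enum.
case/row_free_minorP => c /eqP[].
have -> : colsub c (map_mx (mmap iota y) (gen_polar tau)) =
    map_mx (mmap iota y) (colsub (finfun c) (gen_polar tau)).
  by apply/matrixP => a b; rewrite !mxE ffunE.
rewrite det_map_mx; apply: ev0; rewrite !mem_cat.
apply/orP; right; apply/orP; right.
by apply/mapP; exists (finfun c); rewrite ?mem_enum.
Qed.

End GenericMatrix.

(** * Specialization *)

Section Specialization.
Variables (K : numClosedFieldType) (n p : nat) (le_pn : (p.+1 <= n)%N).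
Variables (g : p.+1.-tuple {mpoly rat[n]}) (A : 'M[rat]_n).
Local Notation A0 := (map_mx ratr A : 'M[K]_n).

Definition spec_coef : {rmorphism {mpoly rat[n * n]} -> K} :=
  mmap ratr (mxvec A0 0).

(** Specializes the entries of A and substitutes y = A x at once, so that gradients in x are
    gradients in y multiplied by A. *)
Definition spec : {rmorphism {mpoly {mpoly rat[n * n]}[n]} -> {mpoly K[n]}} :=
  mmap (@mpolyC n K \o spec_coef) (fun l => \sum_j A0 l j *: 'X_j).

Let f : p.+1.-tuple {mpoly K[n]} :=
  [tuple map_mpoly ratr (lin_subst A (tnth g k)) | k < p.+1].

Lemma specC c : spec c%:MP = (spec_coef c)%:MP. Proof. exact: mmapC. Qed.

Lemma spec_poly q : spec (gen_poly n q) = map_mpoly ratr (lin_subst A q).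
Proof.
pose psi : {rmorphism {mpoly rat[n]} -> {mpoly K[n]}} :=
  map_mpoly ratr \o comp_mpoly [tuple \sum_(j < n) A i j *: 'X_j | i < n].
apply: (mpoly_rmorph_eq (phi := spec \o gen_poly n) (psi := psi)) => [c|i] /=.
  by rewrite map_mpolyC specC /= mmapC comp_mpolyC map_mpolyC.
rewrite [map_mpoly _ 'X_i]mmapXU mmapXU comp_mpolyXU -tnth_nth tnth_mktuple.
rewrite rmorph_sum; apply: eq_bigr => j _ /=.
by rewrite mxE map_mpolyZ [map_mpoly _ 'X_j]mmapXU.
Qed.

Lemma mderiv_spec q j :
  (spec q)^`M(j) = \sum_l spec q^`M(l) * (A0 l j)%:MP.
Proof.
rewrite (@derivation_mmap _ _ _ (@mpolyC n K \o spec_coef) _ (mderiv j)).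
- apply: eq_bigr => l _; congr (_ * _); rewrite (raddf_sum (mderiv j)) (bigD1 j) //=.
  rewrite big1 => [|k /negPf kj]; rewrite mderivZ mderivXU.
    by rewrite eqxx addr0 -mul_mpolyC mulr1.
  by rewrite kj scaler0.
- exact: mderivD.
- exact: mderivM.
- by move=> c; apply: mderivC.
Qed.

Lemma spec_mx : map_mx spec (gen_mx n) = map_mx (@mpolyC n K) A0.
Proof.
apply/matrixP => l j; rewrite !mxE specC /= mmapXU mxvecE mxE //.
Qed.

Lemma spec_jacobian : map_mx spec (gen_jacobian (tnth g) *m gen_mx n) = jacobian f.
Proof.
apply/matrixP => k j; rewrite map_mxM spec_mx !mxE tnth_mktuple -spec_poly mderiv_spec.
by apply: eq_bigr => l _; rewrite !mxE.
Qed.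

Lemma spec_minor t : spec (gen_minor le_pn (tnth g) t) = bordered_minor le_pn f t.
Proof.
rewrite /bordered_minor /max_minor det_border_cols -spec_jacobian -map_cofactors.
by rewrite -map_mxM mxE /gen_minor /gen_form -mulmxA.
Qed.

Section Columns.
Variables (i : nat) (le_in : (p + i <= n)%N).

(** With p + 1 equations and indices from 0, column p is the one that borders the first of the
    M_j. *)
Definition polar_col (t : 'I_i) : 'I_n := widen_ord le_in (rshift p t).

Lemma polar_col_inj : injective polar_col.
Proof. by move=> s t /(congr1 val)/= /addnI E; apply: val_inj. Qed.

Lemma leq_polar_col t : (p <= polar_col t)%N. Proof. exact: leq_addr. Qed.

Definition polar_tuple : (p.+1 + i).-tuple {mpoly K[n]} :=
  [tuple of f ++ [tuple bordered_minor le_pn f (polar_col t) | t < i]].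

Lemma polar_tupleE : polar_equations le_pn f i = polar_tuple.
Proof.
rewrite /polar_equations /=; congr (_ ++ _).
transitivity (map (bordered_minor le_pn f) (map polar_col (enum 'I_i))); last first.
  by rewrite -map_comp.
congr (map _ _).
apply: (inj_map val_inj); apply: (irr_sorted_eq ltn_trans ltnn).
- rewrite -[map _ _]/(map (@nat_of_ord n) _).
  rewrite -(filter_map (@nat_of_ord n) (fun j => p <= j < p + i)%N) val_enum_ord.
  exact: sorted_filter ltn_trans _ _ (iota_ltn_sorted _ _).
- rewrite -map_comp (eq_map (g := addn p \o @nat_of_ord i)) //.
  by rewrite map_comp val_enum_ord -iotaDl addn0 iota_ltn_sorted.
move=> j; apply/mapP/mapP => [[l]|[_ /mapP[t _ ->] ->]].
  rewrite mem_filter => /andP[/andP[lepl ltl] _] ->.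
  have lt_i : (l - p < i)%N by rewrite ltn_subLR.
  exists (polar_col (Ordinal lt_i)); last by rewrite /= subnKC.
  by rewrite map_f ?mem_enum.
exists (polar_col t) => //; rewrite mem_filter mem_enum andbT /=.
by rewrite leq_addr ltn_add2l ltn_ord.
Qed.

Variable x : 'rV[K]_n.
Local Notation ev := (meval (x 0) \o spec).

Lemma jacobian_polar_tuple : jacobian_mx (x 0) (tnth polar_tuple) =
  map_mx ev (gen_polar le_pn (tnth g) polar_col) *m A0.
Proof.
have specE q j : (spec q)^`M(j).@[x 0] = \sum_l ev q^`M(l) * A0 l j.
  rewrite mderiv_spec (raddf_sum (meval (x 0))); apply: eq_bigr => l _ /=.
  by rewrite mevalM mevalC.
apply/matrixP => k j; rewrite !mxE.
have tupE : tnth polar_tuple k = spec (match split k with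
    | inl k => gen_poly n (tnth g k)
    | inr t => gen_minor le_pn (tnth g) (polar_col t) end).
  rewrite (tnth_nth 0) nth_cat size_tuple; case: splitP => t ->.
    by rewrite -tnth_nth tnth_mktuple spec_poly.
  by rewrite addKn -tnth_nth tnth_mktuple spec_minor.
rewrite tupE specE; apply: eq_bigr => l _; congr (_ * _); rewrite !mxE.
by case: split => t; rewrite !mxE.
Qed.

(* [gen_form] does not vanish at x because its coefficients on the independent
   rows of the Jacobian include the minor m. *)
Lemma polar_tuple_row_free (Phi : 'I_n -> {mpoly rat[n * n]}) :
  A \in unitmx -> (forall l, spec_coef (Phi l) != 0) ->
  (forall l, exists k, gen_ideal (gen_system le_pn (tnth g) polar_col)
     ((Phi l)%:MP * gen_form le_pn (tnth g) 0 l ^+ k)) ->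
  zeros [set` polar_tuple] x -> ~ sing f x -> (ul_minor le_pn f).@[x 0] != 0 ->
  row_free (jacobian_mx (x 0) (tnth polar_tuple)).
Proof.
move=> unitA Phi0 cert hx nsing mx0.
have unitA0 : A0 \in unitmx by rewrite map_unitmx.
rewrite jacobian_polar_tuple /row_free mxrankMfree ?row_free_unit // -/(row_free _).
have fx k : (tnth f k).@[x 0] = 0.
  by apply: hx; rewrite /= mem_cat mem_tnth.
have JE : map_mx ev (gen_jacobian (tnth g) *m gen_mx n) = jacobian_at f x.
  by rewrite map_mx_comp spec_jacobian.
have freeJ : row_free (jacobian_at f x).
  apply: contrapT => /negP nfree; apply: nsing; split=> // q /tnthP[k ->]; exact: fx.
have cof0 : cofactors le_pn (jacobian_at f x) != 0.
  apply: contraNneq mx0 => c0; have := cofactors_max le_pn (jacobian_at f x).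
  by rewrite c0 mxE /ul_minor -det_map_mx map_mxsub => <-.
(* Here omega A equals the cofactor row times the Jacobian of f, whose rows are independent. *)
have form0 : map_mx ev (gen_form le_pn (tnth g)) != 0.
  apply: contraNneq cof0 => om0; apply/eqP/(row_free_inj freeJ); rewrite mul0mx.
  rewrite -JE -map_cofactors -map_mxM mulmxA [map_mx _ (_ *m _)]map_mxM.
  by rewrite -/(gen_form le_pn (tnth g)) om0 mul0mx.
have [l om_l] : exists l, ev (gen_form le_pn (tnth g) 0 l) != 0.
  apply: contrapT => nex; case/eqP: form0; apply/rowP => l.
  rewrite [LHS]mxE [RHS]mxE; apply: contrapT => oml; apply: nex; exists l.
  exact/eqP.
(* Were the rows dependent, every generator of the system would vanish at x, whereas the certified
   element takes a value Phi(A) omega_l^k that is nonzero. *)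
apply: contrapT => /negP nfree; have [k] := cert l; set q := _ * _ => Iq.
have evq : ev q != 0.
  change ((spec q).@[x 0] != 0).
  rewrite (rmorphM spec) (rmorphXn spec) mevalM specC mevalC (rmorphXn (meval (x 0))).
  exact: mulf_neq0 (Phi0 l) (expf_neq0 _ om_l).
case/eqP: evq; apply: rmorph_gen_ideal Iq => b; rewrite !mem_cat.
case/or3P=> /mapP[t _ ->]; rewrite /=.
- by rewrite spec_poly; have := fx t; rewrite tnth_mktuple.
- rewrite spec_minor; apply: hx; rewrite /= mem_cat; apply/orP; right.
  by apply/mapP; exists t; rewrite ?mem_enum.
- apply/eqP; apply: contraNT nfree => det0; apply/row_free_minorP; exists t.
  move: det0; rewrite -[meval _ _]/(ev _) -det_map_mx; congr (\det _ != 0).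
  by apply/matrixP => a b'; rewrite !mxE.
Qed.

End Columns.

End Specialization.

(** * Polar varieties away from the zeros of m, and the conclusion *)

Section PolarGeometry.
Variables (K : fieldType) (n p : nat) (le_pn : (p.+1 <= n)%N).
Variable f : p.+1.-tuple {mpoly K[n]}.

Lemma sing_zclosed : zclosed (sing f).
Proof.
have -> : sing f = zeros [set` f] `&` zeros [set q | exists c, q = max_minor f c].
  apply/seteqP; split=> [x [fx rk]|x [fx mx]]; split=> //.
    move=> _ [c ->]; apply/eqP; apply: contraNT rk => mc.
    apply/(row_free_minorP (jacobian_at f x)).2; exists c; move: mc.
    by rewrite /max_minor -det_map_mx map_mxsub.
  apply/negP => /(row_free_minorP (jacobian_at f x)).1[c /eqP[]].
  by rewrite -map_mxsub det_map_mx; apply: mx; exists c.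
by apply: zclosedI; apply: zeros_zclosed.
Qed.

(** Each M_j is one of the minors. Conversely, where m is nonzero, the nonzero cofactor row kills
    all admissible columns, the first p of them identically and the others by M_j = 0, so the minors
    in these columns vanish. *)
Lemma polar_variety_off_minor i (Z : set 'rV[K]_n) :
  zeros [set ul_minor le_pn f] `<=` Z ->
  polar_variety f i `\` Z = zeros [set` polar_equations le_pn f i] `\` Z.
Proof.
move=> mZ; apply/seteqP; split=> x [].
  move=> [fx dx] nZ; split=> // q; rewrite /= mem_cat => /orP[/fx//|/mapP[j]].
  rewrite mem_filter => /andP[/andP[lepj ltj] _] ->; apply: dx => [a b ltab|k] /=.
    case: (ltnP a p) => [lta|lea]; last first.
      by move: (leq_ltn_trans lea ltab); rewrite ltnNge -ltnS ltn_ord.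
    by case: (ltnP b p) => [//|_]; apply: leq_trans lepj.
  by case: (ltnP k p) => [ltk|//]; rewrite /= ltn_addr.
move=> hx nZ; split=> //; split=> [q fq|c _ ltc].
  by apply: hx; rewrite /= mem_cat; apply/orP; left.
have mx0 : (ul_minor le_pn f).@[x 0] != 0.
  by apply: contra_notN nZ => /eqP mx0; apply: mZ => _ ->.
rewrite /max_minor -det_map_mx map_mxsub -/(jacobian_at f x).
apply: (minor0_of_cofactors (le_pn := le_pn)) => [|k].
  by rewrite cofactors_max -map_mxsub det_map_mx.
have [ltcp|lepc] := ltnP (c k) p; first exact: cofactors_mul_low.
rewrite -det_border_cols -map_mxsub det_map_mx; apply: hx; rewrite /= mem_cat.
apply/orP; right; apply/mapP; exists (c k) => //.
by rewrite mem_filter mem_enum andbT lepc ltc.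
Qed.

End PolarGeometry.

Theorem theorem8 (R : realType) (n p : nat) (p_gt0 : (1 <= p)%N)
    (le_pn : (p <= n)%N) (g : p.-tuple {mpoly rat[n]})
    (g_reg : reduced_regular_seq g) :
  exists U : set 'M[R[i]]_n,
    [/\ zopen_GL U, U !=set0 &
        forall A : 'M[rat]_n, A \in unitmx -> U (map_mx ratr A) ->
          let f : p.-tuple {mpoly R[i][n]} :=
            [tuple map_mpoly ratr (lin_subst A (tnth g k)) | k < p] in
          let Z := sing f `|` zeros [set ul_minor le_pn f] in
          forall i : nat, (1 <= i <= n - p)%N ->
            let W := polar_variety f i in
            let h := polar_equations le_pn f i in
            [/\ W `\` Z = set0 \/ smooth_variety (p + i) (W `\` Z),
                W `\` Z = zeros [set` h] `\` Z &
                regular_seq_outside Z h]].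
Proof.
move: le_pn g g_reg; case: p p_gt0 => // {}p _ le_pn g _.
have le_in (i : 'I_(n - p.+1).+1) : (p + i <= n)%N.
  by move: (ltn_ord i); rewrite ltnS leq_subRL // addSn => /ltnW.
have cert (il : 'I_(n - p.+1).+1 * 'I_n) : exists Phi : {mpoly rat[n * n]}, Phi != 0 /\
    exists k, gen_ideal (gen_system le_pn (tnth g) (polar_col (le_in il.1)))
      (Phi%:MP * gen_form le_pn (tnth g) 0 il.2 ^+ k).
  apply: gen_certificate; [exact: polar_col_inj|exact: leq_polar_col].
have [Phi PhiP] := choice cert.
(* There is one factor for each i and each coordinate of omega: U must not depend on i, and which
   coordinate of omega is nonzero varies with the point. *)
pose F : {mpoly R[i][n * n]} := \prod_il map_mpoly ratr (Phi il).
pose U := [set A : 'M[R[i]]_n | A \in unitmx /\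
  exists2 q, [set F] q & q.@[mxvec A 0] != 0].
exists U; split; first by exists [set F].
  (* A point where F times the generic determinant is nonzero is an invertible matrix in U. *)
  pose dt : {mpoly R[i][n * n]} := \det (\matrix_(l < n, j < n) 'X_(mxvec_index l j)).
  have dtE (A : 'M[R[i]]_n) : dt.@[mxvec A 0] = \det A.
    rewrite -det_map_mx; congr (\det _); apply/matrixP => l j.
    by rewrite !mxE /= mevalXU mxvecE.
  have [|a] := @meval_nonzero _ _ (F * dt).
    rewrite mulf_neq0 //.
      apply/prodf_neq0 => il _; have [Phi0 _] := PhiP il; apply: contraNneq Phi0 => E.
      apply/eqP/mpolyP => m; apply: (fmorph_inj (@ratr R[i])).
      by rewrite -mcoeff_map_mpoly E !mcoeff0 rmorph0.
    apply/eqP => dt0; have := dtE 1%:M; rewrite dt0 meval0 det1 => /esym/eqP.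
    by rewrite oner_eq0.
  rewrite mevalM mulf_eq0 negb_or => /andP[Fa dta].
  have aE q : q.@[a] = q.@[mxvec (vec_mx (\row_k a k)) 0] :> R[i].
    by apply: meval_eq => k; rewrite vec_mxK mxE.
  exists (vec_mx (\row_k a k)); split; first by rewrite unitmxE unitfE -dtE -aE.
  by exists F; rewrite -?aE.
move=> A unitA [_ [_ -> FA]] f Z i /andP[_ le_i] W h.
have lti : (i < (n - p.+1).+1)%N by rewrite ltnS.
have hE : h = polar_tuple R[i] le_pn g A (le_in (Ordinal lti)) by apply: polar_tupleE.
have WZ : W `\` Z = zeros [set` h] `\` Z.
  by apply: polar_variety_off_minor => x; right.
have closedZ : zclosed Z.
  by apply: zclosedU; [apply: sing_zclosed|apply: zeros_zclosed].
have freeJ x : (zeros [set` h] `\` Z) x ->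
    row_free (jacobian_mx (x 0) (tnth (polar_tuple R[i] le_pn g A (le_in (Ordinal lti))))).
  move=> [hx nZ].
  apply: (@polar_tuple_row_free _ _ _ _ _ _ _ _ _ (fun l => Phi (Ordinal lti, l))).
  - exact: unitA.
  - move=> l; move: FA; rewrite rmorph_prod => /prodf_neq0/(_ (Ordinal lti, l) isT).
    apply: contraNneq => E; apply/eqP; rewrite -[RHS]E.
    apply: (mpoly_rmorph_eq (phi := meval (mxvec (map_mx ratr A) 0) \o map_mpoly ratr)
      (psi := spec_coef R[i] A)) => [c|k] /=.
      by rewrite map_mpolyC mevalC mmapC.
    by rewrite [map_mpoly _ _]mmapXU mevalXU mmapXU.
  - by move=> l; case: (PhiP (Ordinal lti, l)).
  - by move: hx; rewrite hE.
  - by move=> sx; apply: nZ; left.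
  - by apply/eqP => mx0; apply: nZ; right=> _ ->.
rewrite WZ; split=> //.
  right; rewrite hE in freeJ *; exact: smooth_complete_intersection.
by rewrite hE in freeJ *; apply: regular_seq_complete_intersection.
Qed.
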